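(* Let $2<p<\infty$. There exists a constant $c=c(p)>0$, depending only on $p$, such that the following holds. Let $(\Omega,\mathcal F,\mu)$ be a probability space, let $m\in\mathbb N$, and let $\xi^1,\ldots,\xi^m$ be independent random points in $\Omega$ (not necessarily identically distributed) satisfying \[ \mu(E)=\frac1m\sum_{j=1}^m\mathbb P\{\xi^j\in E\},\qquad E\in\mathcal F. \] Let $X_N\subset B(\Omega)$ be a finite-dimensional linear subspace of bounded functions such that, for some $H\ge 16$, \[ \|f\|_\infty\le H^{1/p}\|f\|_{L_p(\mu)}\qquad\text{for all } f\in X_N . \] If $\lambda\ge e$ and $\varepsilon\in(0,1/2]$ are such that \[ m\ge\bigl(\lambda\,\varepsilon^{-1}\log\varepsilon^{-1}\bigr)^p\,H\log H\,(\log\log H)^{p-1}, \] then with probability at least $1-2e^{-c\lambda}$ one has \[ (1-\varepsilon)\|f\|_{L_p(\mu)}^p\le\frac1m\sum_{j=1}^m|f(\xi^j)|^p\le(1+\varepsilon)\|f\|_{L_p(\mu)}^p\qquad\text{for all } f\in X_N . \]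
   Context: $B(\Omega)$ is the space of bounded functions $f\colon\Omega\to\mathbb C$ with $\|f\|_\infty=\sup_{x\in\Omega}|f(x)|$ (a genuine supremum, not an essential one). $\|f\|_{L_p(\mu)}=(\int_\Omega|f|^p\,d\mu)^{1/p}$; the functions in $X_N$ are $\mathcal F$-measurable. $\log$ is the natural logarithm. *)

(* Defs.v *)
From HB Require Import structures.
From mathcomp Require Import all_boot all_order all_algebra.
From mathcomp Require Import complex.
From mathcomp Require Import all_classical all_reals all_analysis.

Set Implicit Arguments.
Unset Strict Implicit.
Unset Printing Implicit Defensive.

Import Order.TTheory GRing.Theory Num.Theory.
Import numFieldNormedType.Exports.

Local Open Scope classical_set_scope.
Local Open Scope ring_scope.

(* [Normc.normc : R[i] -> R] is the modulus with values in [R]; the norm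
   [`|z|] of [z : R[i]] lives in [R[i]]. *)

Definition bounded_function (R : realType) (T : Type) (f : T -> R[i]) : Prop :=
  has_ubound (range (fun x => Normc.normc (f x))).

Definition supnorm (R : realType) (T : Type) (f : T -> R[i]) : R :=
  sup (range (fun x => Normc.normc (f x))).

(* R[i] carries no measurableType structure in the library. *)
Definition measurable_complex (R : realType) (d : measure_display)
    (T : measurableType d) (f : T -> R[i]) : Prop :=
  measurable_fun setT (fun x => complex.Re (f x)) /\
  measurable_fun setT (fun x => complex.Im (f x)).

(* The extended real [Lnorm] is finite on bounded measurable functions when
   mu is a probability and p > 0, so that [fine] loses nothing there. *)
Definition Lpnorm (R : realType) (d : measure_display) (T : measurableType d)
    (mu : {measure set T -> \bar R}) (p : R) (f : T -> R[i]) : R :=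
  fine (Lnorm mu p%:E (fun x => (Normc.normc (f x))%:E)).

Definition linear_subspace (R : realType) (T : Type) (X : set (T -> R[i])) :
    Prop :=
  X (fun _ => 0) /\
  forall (a : R[i]) (f g : T -> R[i]), X f -> X g ->
    X (fun x => a * f x + g x).

Definition finite_dimensional (R : realType) (T : Type)
    (X : set (T -> R[i])) : Prop :=
  exists (N : nat) (e : 'I_N -> T -> R[i]),
    (forall i, X (e i)) /\
    forall f, X f ->
      exists a : 'I_N -> R[i], f = (fun x => \sum_(i < N) a i * e i x).

Definition independent_points (R : realType) (d d' : measure_display)
    (W : measurableType d') (T : measurableType d) (P : probability W R)
    (m : nat) (xi : 'I_m -> {mfun W >-> T}) : Prop :=
  forall (J : {set 'I_m}) (E : 'I_m -> set T),
    (forall j, measurable (E j)) ->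
    P (\bigcap_(j in [set j | j \in J]) (xi j @^-1` E j)) =
    (\prod_(j in J) P (xi j @^-1` E j))%E.

Definition discretization_event (R : realType) (d d' : measure_display)
    (W : measurableType d') (T : measurableType d)
    (mu : {measure set T -> \bar R}) (m : nat) (xi : 'I_m -> {mfun W >-> T})
    (X : set (T -> R[i])) (p eps : R) : set W :=
  [set w | forall f, X f ->
     (1 - eps) * Lpnorm mu p f `^ p
       <= m%:R^-1 * \sum_(j < m) Normc.normc (f (xi j w)) `^ p
       <= (1 + eps) * Lpnorm mu p f `^ p].

(* Main.v *)
Require Import Defs.
From HB Require Import structures.
From mathcomp Require Import all_boot all_order all_algebra.
From mathcomp Require Import complex.
From mathcomp Require Import all_classical all_reals all_analysis.
From mathcomp Require Import measurable_realfun.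
From mathcomp Require Import ring lra.

Set Implicit Arguments.
Unset Strict Implicit.
Unset Printing Implicit Defensive.

Import Order.TTheory GRing.Theory Num.Theory.
Import numFieldNormedType.Exports.

Local Open Scope classical_set_scope.
Local Open Scope ring_scope.

(** Put [psi f = ||f||_p^p]. By Clarkson's inequality [psi] is uniformly convex
    of power type [p], so mirror descent with potential [psi] learns the values
    of any [f] with [psi f <= 1] at the sample points: as long as the current
    iterate is off by more than [s] at some point, a step of size
    [~ s^(p-1) / H] in the direction of that point evaluation gains [~ s^p / H].
    Every step is described by one of [O(m)] symbols, so [f] gets, at all scales
    [s_i = H^(1/p) 2^-i] simultaneously, an approximant with a code of length
    [k_i] such that [sum_i k_i s_i^p <= K H]. This single bound replaces the
    entropy estimates for the unit ball in the uniform norm.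

    To compare two independent samples, [|f|^p] is cut into dyadic bands of its
    values; in the band at height [t], one chains along the approximants from
    scale [t] down to scale [eps t]. Chernoff's bound for random signs, applied to
    the links of all chains, controls the deviation by a small multiple of the
    empirical [p]-th moment plus [O(U H eps^-(p-1) / m)], where [U ~ lambda log m]. *)

(** The deviation is a supremum over an uncountable family. The space is therefore cut into finitely
    many cells on which finitely many [|f|^p] are almost constant, so that probabilities are finite
    sums of product weights; a countable dense family and continuity from above recover the full
    event at the end.

    The union bound ranges over codes and not over [f], so an approximant must depend on its code
    alone: a code names a near-minimizer of [psi] minus a sum of point evaluations, and [f] only
    decides which symbol comes next. The [log m] in [U] pays for an alphabet of [8 * m + 1] symbols:
    a code of length [k] is charged [exp (- U k)], and all codes together cost a geometric series.

    Refining a link by one dyadic step divides its variance by 4 but multiplies the admissible code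
    length by [2 ^ p]. For [p > 2] the contributions therefore grow geometrically with the depth and
    the finest level dominates, which is the origin of [eps^-(p-1)]. *)

(** * Elementary inequalities for real powers *)

Section power_inequalities.
Context {R : realType}.
Implicit Types (p x y z s t : R).

Lemma ler_powR2 p x y : 0 <= p -> 0 <= x -> x <= y -> x `^ p <= y `^ p.
Proof.
by move=> p0 x0 xy; rewrite ge0_ler_powR// nnegrE// (le_trans x0).
Qed.

Lemma powR_half_le p x : 1 <= p -> 0 <= x -> (x / 2) `^ p <= x `^ p / 2.
Proof.
move=> p1 x0; rewrite powRM// [leRHS]mulrC [leLHS]mulrC ler_wpM2r ?powR_ge0//.
by apply: ge1r_powR => //; lra.
Qed.

Lemma bernoulli_onem n x : 0 <= x <= 1 -> 1 - x ^+ n <= n%:R * (1 - x).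
Proof.
move=> /andP[x0 x1]; elim: n => [|n IH]; first by rewrite expr0 subrr mul0r.
have xn : 0 <= x ^+ n <= 1 by rewrite exprn_ge0//= exprn_ile1.
rewrite exprS -natr1; nra.
Qed.

Lemma onem_powR_le n p t : 1 <= p <= n%:R -> 0 <= t <= 1 ->
  1 - t `^ p <= n%:R * (1 - t).
Proof.
move=> /andP[p1 pn] /andP[t0 t1].
have [->|tn0] := eqVneq t 0; first by rewrite powR0; lra.
have tgt0 : 0 < t by rewrite lt_neqAle eq_sym tn0.
have : t ^+ n <= t `^ p by rewrite -powR_mulrn// ger_powR// tgt0.
by have := @bernoulli_onem n t; rewrite t0 t1 => /(_ isT); lra.
Qed.

(* A natural number [n >= p] replaces the sharp constant [p], so that
   Bernoulli's inequality for natural exponents suffices. *)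
Lemma powR_lipschitz n p x y s : 1 <= p <= n%:R -> 0 <= x <= y -> y <= s ->
  y `^ p - x `^ p <= n%:R * s `^ (p - 1) * (y - x).
Proof.
move=> pn /andP[x0 xy] ys; have /andP[p1 _] := pn.
have y0 : 0 <= y by exact: le_trans xy.
have [y00|yn0] := eqVneq y 0.
  have -> : x = 0 by apply/eqP; rewrite eq_le x0 andbT -y00.
  by rewrite y00 !subrr mulr0.
have ygt0 : 0 < y by rewrite lt_neqAle eq_sym yn0.
have p0 : 0 < p by lra.
have t01 : 0 <= x / y <= 1 by rewrite divr_ge0//= ler_pdivrMr// mul1r.
have xE : x = y * (x / y) by rewrite mulrC divfK.
have /andP[t0 t1] := t01.
rewrite [in leLHS]xE powRM// -{1}[y `^ p]mulr1 -mulrBr -(mulr_powRB1 y0 p0).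
have -> : y - x = y * (1 - x / y) by rewrite mulrBr mulr1 -xE.
have h1 : y `^ (p - 1) <= s `^ (p - 1) by rewrite ler_powR2//; lra.
have h2 := onem_powR_le pn t01.
have h3 : 0 <= y `^ (p - 1) by exact: powR_ge0.
have h4 : 0 <= n%:R * (1 - x / y) by rewrite mulr_ge0//; lra.
rewrite (_ : n%:R * s `^ (p - 1) * (y * (1 - x / y)) =
  y * (s `^ (p - 1) * (n%:R * (1 - x / y)))); last by ring.
rewrite -mulrA ler_wpM2l//.
apply: (@le_trans _ _ (y `^ (p - 1) * (n%:R * (1 - x / y)))).
  by rewrite ler_wpM2l.
by rewrite ler_wpM2r.
Qed.

Lemma powR_midpoint p x y : 1 <= p -> 0 <= x -> 0 <= y ->
  ((x + y) / 2) `^ p <= (x `^ p + y `^ p) / 2.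
Proof.
move=> p1 x0 y0.
have h0 : 0 <= 2^-1 :> R by lra.
have h1 : 2^-1 <= 1 :> R by lra.
pose t := Itv01 h0 h1.
have := @convex_powR R p p1 t x y.
rewrite !inE /= !in_itv /= !andbT => /(_ x0 y0).
rewrite /conv/= /GRing.scale/=.
rewrite -[conv t _ _]/(2^-1 * x `^ p + unstable.onem 2^-1 * y `^ p).
have -> : unstable.onem 2^-1 = 2^-1 :> R by rewrite /unstable.onem; lra.
by rewrite -!mulrDr ![2^-1 * _]mulrC.
Qed.

Lemma powR_superadd p x y : 1 <= p -> 0 <= x -> 0 <= y ->
  x `^ p + y `^ p <= (x + y) `^ p.
Proof.
move=> p1 x0 y0.
have p0 : 0 < p by lra.
have xy0 : 0 <= x + y by exact: addr_ge0.
rewrite -(mulr_powRB1 x0 p0) -(mulr_powRB1 y0 p0) -(mulr_powRB1 xy0 p0) mulrDl.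
by rewrite lerD// ler_wpM2l// ler_powR2 ?lerDl ?lerDr//; lra.
Qed.

End power_inequalities.

(** * Mirror descent over finitely many point evaluations *)

Section greedy_net.
Context {R : realType} {V : Type} {A : finType}.
Variables (p H : R) (psi : V -> R) (mid : V -> V -> V) (D : V -> V -> R).
Variables (L : A -> V -> R) (s : nat -> R) (v0 : V).
Hypotheses (p1 : 1 <= p) (H0 : 0 < H).
Hypothesis psi_ge0 : forall g, 0 <= psi g.
Hypothesis psi_mid : forall g h, psi (mid g h) + D g h <= (psi g + psi h) / 2.
Hypothesis L_mid : forall a g h, L a (mid g h) = (L a g + L a h) / 2.
Hypothesis L_le : forall a g h,
  `|L a g - L a h| `^ p <= 2 `^ p * H * D g h.
Hypothesis s_gt0 : forall i, 0 < s i.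
Hypothesis s_half : forall i, s i.+1 = s i / 2.

(* A code is read from its tail: [Some a] is a descent step in direction [a] at
   the current scale, and [None] passes to the next scale. *)
Implicit Types c : seq (option A).

(** Chosen so that [step_tradeoff] just closes: [8 = 4 * 2], where 4 comes from its threshold
    [s i / 4] and 2 from the factor [2 ^ p] in [L_le]. *)
Definition greedy_rate : R := 8 `^ (1 - p).

Definition stepsize i : R := greedy_rate * s i `^ (p - 1) / H.

Definition stage c : nat := count (fun o => o == None) c.

Fixpoint dual c (g : V) : R :=
  match c with
  | [::] => 0
  | None :: c' => dual c' g
  | Some a :: c' => dual c' g + stepsize (stage c') * L a g
  end.

Fixpoint energy c : R :=
  match c with
  | [::] => 0
  | None :: c' => energy c'
  | Some a :: c' => energy c' + stepsize (stage c') * s (stage c')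
  end.

Definition objective c (g : V) : R := psi g - dual c g.

(** Two tolerances plus the loss [stepsize * s / 4] of [step_tradeoff] consume 3/8 of the gain
    [stepsize * s] of a step, so at least half of it survives. *)
Definition tolerance c : R := stepsize (stage c) * s (stage c) / 16.

(** [V] carries no topology in which the infimum would be attained, hence minimizers up to a
    tolerance. *)
Definition near_minimizer c (h : V) : Prop :=
  forall g, objective c h <= objective c g + tolerance c.

Lemma stepsize_gt0 i : 0 < stepsize i.
Proof. by rewrite divr_gt0// mulr_gt0// powR_gt0. Qed.

Lemma tolerance_gt0 c : 0 < tolerance c.
Proof. by rewrite divr_gt0// mulr_gt0// stepsize_gt0. Qed.

Lemma dual_mid c g h : dual c (mid g h) = (dual c g + dual c h) / 2.
Proof.
elim: c => [|[a|] c IH] //=; first by rewrite addr0 mul0r.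
by rewrite IH L_mid; lra.
Qed.

Lemma near_minimizer_exists c (b : R) :
  (forall g, b <= objective c g) -> exists h, near_minimizer c h.
Proof.
move=> lb; pose S := [set objective c g | g in setT].
have hinf : has_inf S.
  by split; [exists (objective c v0), v0|exists b => _ [g _ <-]].
have [_ [h _ <-] hh] := inf_adherent (tolerance_gt0 c) hinf.
exists h => g; apply: (le_trans (ltW hh)); rewrite lerD2r.
by apply: ge_inf; [case: hinf|exists g].
Qed.

(** A displacement [w <= s i / 4] is cheap in the linear term; for a larger one the convexity gain
    [2 * d], of order [w ^ p / H], outweighs that term. *)
Lemma step_tradeoff i (w d : R) : 0 <= w -> w `^ p <= 2 `^ p * H * d ->
  - (stepsize i * s i / 4) <= 2 * d - stepsize i * w.
Proof.
move=> w0 wd.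
have d0 : 0 <= d.
  have : 0 <= 2 `^ p * H * d by exact: le_trans (powR_ge0 _ _) wd.
  by rewrite pmulr_rge0// mulr_gt0// powR_gt0.
have e0 := stepsize_gt0 i; have si := s_gt0 i.
have [ws|sw] := leP w (s i / 4).
  have : stepsize i * w <= stepsize i * (s i / 4) by rewrite ler_wpM2l// ltW.
  by lra.
suff h : stepsize i * w <= 2 * d by have := mulr_gt0 e0 si; lra.
have w0' : 0 < w by lra.
have p0 : 0 < p by exact: lt_le_trans ltr01 p1.
have {wd} : w * w `^ (p - 1) <= 2 `^ p * H * d by rewrite mulr_powRB1.
have sw' : s i `^ (p - 1) <= 4 `^ (p - 1) * w `^ (p - 1).
  by rewrite -powRM ?(ltW w0')//; apply: ler_powR2; have := p1; lra.
move=> wd.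
have E : greedy_rate * 4 `^ (p - 1) * 2 `^ (p - 1) = 1.
  rewrite /greedy_rate -mulrA -powRM//.
  rewrite (_ : 4 * 2 = 8 :> R); last by lra.
  rewrite -powRD; last by rewrite pnatr_eq0 implybT.
  have -> : 1 - p + (p - 1) = 0 by ring.
  exact: powRr0.
have E2 : 2 `^ p = 2 * 2 `^ (p - 1) :> R by rewrite mulr_powRB1.
have P2 : 0 < 2 `^ (p - 1) :> R by rewrite powR_gt0.
have Pg : 0 < greedy_rate by rewrite powR_gt0.
rewrite /stepsize mulrAC ler_pdivrMr//.
apply: (@le_trans _ _ (greedy_rate * (4 `^ (p - 1) * w `^ (p - 1)) * w)).
  by rewrite ler_wpM2r// ler_wpM2l// ltW.
rewrite (_ : _ * w = greedy_rate * 4 `^ (p - 1) * (w * w `^ (p - 1))); last by ring.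
apply: (@le_trans _ _ (greedy_rate * 4 `^ (p - 1) * (2 `^ p * H * d))).
  by rewrite ler_wpM2l// mulr_ge0// ?powR_ge0.
rewrite E2 le_eqVlt; apply/orP; left; apply/eqP.
transitivity (greedy_rate * 4 `^ (p - 1) * 2 `^ (p - 1) * (2 * H * d)); first by ring.
by rewrite E; ring.
Qed.

(** Comparing [h] with [mid g h] yields [objective c g >= objective c h + 2 * D g h - 2 * tolerance
    c]; the term in [D] absorbs the change of [L a] between [h] and [g]. *)
Lemma objective_step a c h g : near_minimizer c h ->
  objective c h - 2 * tolerance c - stepsize (stage c) * L a h
    - stepsize (stage c) * s (stage c) / 4 <= objective (Some a :: c) g.
Proof.
move=> hmin.
have := step_tradeoff (stage c) (normr_ge0 _) (L_le a g h).
have := hmin (mid g h); have := psi_mid g h.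
rewrite {2 4}/objective /= dual_mid.
have : L a g - L a h <= `|L a g - L a h| by exact: ler_norm.
have := stepsize_gt0 (stage c).
move: (stepsize _) (`|_ - _|) => e w e0 lw.
have : e * (L a g - L a h) <= e * w by rewrite ler_wpM2l// ltW.
rewrite /objective; lra.
Qed.

(** Boundedness below propagates from the near-minimizer of the tail. [None] leaves the objective
    unchanged but lowers the tolerance, so a new point is selected. *)
Lemma near_minimizerP c : exists h, near_minimizer c h.
Proof.
elim: c => [|[a|] c [h hmin]].
- by apply: (@near_minimizer_exists _ 0) => g; rewrite /objective /= subr0.
- exact: near_minimizer_exists (fun g => objective_step a g hmin).
- apply: (@near_minimizer_exists _ (objective c h - tolerance c)) => g.
  by rewrite lerBlDr; exact: hmin.
Qed.

Definition greedy_point c : V := sval (cid (near_minimizerP c)).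

Lemma greedy_pointP c : near_minimizer c (greedy_point c).
Proof. exact: svalP (cid (near_minimizerP c)). Qed.

Fixpoint greedy_for (f : V) c : Prop :=
  match c with
  | [::] => True
  | None :: c' => greedy_for f c'
  | Some a :: c' =>
      greedy_for f c' /\ s (stage c') < L a f - L a (greedy_point c')
  end.

(** Each admissible step raises the lower bound of the objective, up to a term linear in [f]. At
    [g = f] the dual terms cancel, which bounds the energy by [2 * psi f]. *)
Lemma greedy_objective_ge f c : greedy_for f c ->
  forall g, energy c / 2 - dual c f <= objective c g.
Proof.
elim: c => [_ g|[a|] c IH] //=.
  by rewrite /objective /= mul0r subr0 subr0.
move=> [/IH{}IH gap] g.
apply: le_trans (objective_step a g (greedy_pointP c)).
have := IH (greedy_point c); have e0 := stepsize_gt0 (stage c).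
have s0 := s_gt0 (stage c).
have : stepsize (stage c) * s (stage c) <=
  stepsize (stage c) * (L a f - L a (greedy_point c)).
  by rewrite ler_wpM2l// ltW.
have : 0 < stepsize (stage c) * s (stage c) by exact: mulr_gt0.
rewrite /tolerance; lra.
Qed.

Lemma greedy_energy_le f c : greedy_for f c -> energy c <= 2 * psi f.
Proof. by move=> /greedy_objective_ge/(_ f); rewrite /objective; lra. Qed.

(** The steps at a fixed scale must stop: each adds the same amount to the energy, which never
    exceeds [2 * psi f]. *)
Lemma greedy_extend f c : greedy_for f c -> exists k : seq A,
  greedy_for f (map Some k ++ c) /\
  forall a, L a f - L a (greedy_point (map Some k ++ c)) <= s (stage c).
Proof.
have e0 : 0 < stepsize (stage c) * s (stage c).
  by rewrite mulr_gt0// stepsize_gt0.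
have [n] : exists n : nat, 2 * psi f < energy c + n%:R *
    (stepsize (stage c) * s (stage c)).
  have [n hn] : exists n : nat, (2 * psi f - energy c) /
      (stepsize (stage c) * s (stage c)) < n%:R.
    eexists; apply: le_lt_trans (ler_norm _) _.
    exact: archi_boundP (normr_ge0 _).
  by exists n; move: hn; rewrite ltr_pdivrMr//; lra.
elim: n c e0 => [|n IH] c e0; first by move=> + /greedy_energy_le; lra.
move=> hn cf.
have [hall|/existsNP[a /negP]] := pselect (forall a,
    L a f - L a (greedy_point c) <= s (stage c)).
  by exists [::].
rewrite -ltNge => ha.
have sE : stage (Some a :: c) = stage c by rewrite /stage/= add0n.
have hn' : 2 * psi f < energy (Some a :: c) +
    n%:R * (stepsize (stage c) * s (stage c)).
  by move: hn; rewrite -natr1 /=; lra.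
have := IH (Some a :: c); rewrite sE => /(_ e0 hn' (conj cf ha)) [k [kg kall]].
exists (rcons k a); rewrite map_rcons cat_rcons; by split.
Qed.

Fixpoint weight c : R :=
  match c with
  | [::] => 0
  | _ :: c' => weight c' + s (stage c') `^ p
  end.

Lemma weight_le c :
  weight c <= H / greedy_rate * energy c + \sum_(i < stage c) s i `^ p.
Proof.
elim: c => [|[a|] c IH] /=.
- by rewrite /stage/= big_ord0 mulr0 addr0.
- rewrite /stage/= add0n -/(stage c) mulrDr addrAC lerD//.
  rewrite /stepsize -(mulr_powRB1 (ltW (s_gt0 _)) (lt_le_trans ltr01 p1)).
  have : 0 < greedy_rate by rewrite powR_gt0.
  move=> gr0; rewrite le_eqVlt; apply/orP; left; apply/eqP.
  by field; rewrite !gt_eqF.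
- by rewrite {2}/stage/= add1n -/(stage c) big_ord_recr /= addrA lerD2r.
Qed.

Lemma stage_cat (k : seq A) c : stage (map Some k ++ c) = stage c.
Proof. by elim: k. Qed.

Lemma weight_cat (k : seq A) c :
  weight (map Some k ++ c) = weight c + (size k)%:R * s (stage c) `^ p.
Proof.
elim: k => [|a k IH] /=; first by rewrite mul0r addr0.
by rewrite IH stage_cat -natr1; ring.
Qed.

Lemma sum_powR_scale_le n : \sum_(i < n) s i `^ p <= 2 * s 0%N `^ p.
Proof.
suff : \sum_(i < n) s i `^ p + 2 * s n `^ p <= 2 * s 0%N `^ p.
  by have := powR_ge0 (s n) p; lra.
elim: n => [|n IH]; first by rewrite big_ord0 add0r.
rewrite big_ord_recr /= s_half.
have := powR_half_le p1 (ltW (s_gt0 n)); lra.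
Qed.

(** One run serves all scales, each code extending the previous one. A symbol written at scale [j]
    reappears in every later code, and the powers [s i ^ p] with [i >= j] sum to at most
    [2 * s j ^ p]; hence the total is at most twice the weight. *)
Lemma greedy_codes f : psi f <= 1 -> exists c : nat -> seq (option A),
  [/\ forall i a, L a f - L a (greedy_point (c i)) <= s i,
      forall i, (i <= size (c i))%N,
      forall i, (size (c i) <= size (c i.+1))%N &
      forall n, \sum_(i < n) (size (c i))%:R * s i `^ p <=
        4 * (H / greedy_rate + s 0%N `^ p)].
Proof.
move=> f1.
have ext c : {k : seq A | greedy_for f c ->
    greedy_for f (map Some k ++ c) /\
    forall a, L a f - L a (greedy_point (map Some k ++ c)) <= s (stage c)}.
  apply: cid; have [cf|] := pselect (greedy_for f c); last by exists [::].
  by have [k hk] := greedy_extend cf; exists k.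
pose comp c := map Some (sval (ext c)) ++ c.
pose c := fix c i := if i is j.+1 then comp (None :: c j) else comp [::].
have cP i : greedy_for f (c i) /\ stage (c i) = i.
  elim: i => [|i [IH1 IH2]] /=.
    by split; [exact: (svalP (ext [::]) I).1|rewrite stage_cat].
  split; first exact: (svalP (ext (None :: c i)) IH1).1.
  by rewrite stage_cat /stage/= add1n -/(stage _) IH2.
exists c; split.
- move=> [|i] a /=; first exact: (svalP (ext [::]) I).2.
  apply: (le_trans ((svalP (ext (None :: c i)) (cP i).1).2 a)).
  by rewrite /stage/= add1n -/(stage _) (cP i).2.
- elim => // i IH /=; rewrite size_cat /= addnS ltnS.
  by rewrite (leq_trans IH)// leq_addl.
- by move=> i /=; rewrite size_cat /= addnS; apply: leqW; exact: leq_addl.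
- move=> n.
  have wle i : weight (c i) <= 2 * (H / greedy_rate + s 0%N `^ p).
    apply: le_trans (weight_le _) _; rewrite mulrDr lerD ?sum_powR_scale_le//.
    rewrite mulrC ler_wpM2r//; last first.
      by apply: (le_trans (greedy_energy_le (cP i).1)); lra.
    by rewrite divr_ge0// ?powR_ge0// ltW.
  have step i : weight (c i) +
      ((size (c i.+1))%:R - (size (c i))%:R) * s i.+1 `^ p <= weight (c i.+1).
    have wN (k : seq A) c0 : weight (map Some k ++ None :: c0) =
        weight c0 + s (stage c0) `^ p + (size k)%:R * s (stage c0).+1 `^ p.
      by rewrite weight_cat /= /stage/= add1n.
    rewrite /= /comp; move: (sval _) => k.
    rewrite wN size_cat size_map /= addnS -natr1 natrD (cP i).2.
    have : s i.+1 `^ p <= s i `^ p.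
      by apply: ler_powR2; rewrite ?s_half; have := s_gt0 i; have := p1; lra.
    by have := powR_ge0 (s i.+1) p; lra.
  (* The second term on the left is a reserve: halving the scale at least halves [s i ^ p], so it
     covers the old symbols at the next scale together with their new reserve. *)
  have main i : \sum_(j < i.+1) (size (c j))%:R * s j `^ p +
      (size (c i))%:R * s i `^ p <= 2 * weight (c i).
    elim: i => [|i IH].
      rewrite big_ord1 /= /comp weight_cat size_cat size_map addn0.
      by rewrite /stage/=; lra.
    rewrite big_ord_recr /=.
    have := step i.
    have : (size (c i))%:R * s i.+1 `^ p <= (size (c i))%:R * (s i `^ p / 2).
      by rewrite ler_wpM2l// s_half powR_half_le// ltW.
    by move: IH; rewrite -/(c i.+1); lra.
  case: n => [|n].
    by rewrite big_ord0; have := wle 0%N; have := main 0%N;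
      rewrite big_ord1; have := powR_ge0 (s 0%N) p;
      have : 0 <= (size (c 0%N))%:R :> R by []; nra.
  have := main n; have := wle n.
  have : 0 <= (size (c n))%:R * s n `^ p by rewrite mulr_ge0 ?powR_ge0.
  lra.
Qed.

End greedy_net.

(** * Exponential tail bounds for finite product weights *)

Section finite_products.
Context {R : realType}.

Lemma expR_le_quadratic (x : R) : x <= 1 / 2 -> expR x <= 1 + x + 2 * x ^+ 2.
Proof.
move=> x12; have x1 : 0 < 1 - x by lra.
have h : expR x <= (1 - x)^-1.
  rewrite -[expR x]invrK -expRN lef_pV2 ?posrE ?expR_gt0//.
  by have := expR_ge1Dx (- x); lra.
apply: (le_trans h); rewrite -[leLHS]mul1r ler_pdivrMr//.
have : 0 <= x ^+ 2 * (1 - 2 * x) by rewrite mulr_ge0 ?sqr_ge0//; lra.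
by rewrite !expr2; nra.
Qed.

(** The constant 2 in place of the sharp 1/2 permits a proof by cases: the quadratic bound for
    [x <= 1 / 2], and [x <= 2 * x ^+ 2] beyond. *)
Lemma cosh_le_gaussian (x : R) : (expR x + expR (- x)) / 2 <= expR (2 * x ^+ 2).
Proof.
wlog x0 : x / 0 <= x.
  move=> hw; have [/hw//|x0] := leP 0 x.
  by have := hw (- x); rewrite opprK sqrrN addrC; apply; lra.
have [x12|x12] := leP x (1 / 2).
  have := expR_le_quadratic x12; have := @expR_le_quadratic (- x).
  rewrite sqrrN => /(_ (le_trans _ x12)) h1 h2.
  apply: le_trans (expR_ge1Dx _).
  by have := h1 ltac:(lra); lra.
have : expR (- x) <= expR x by rewrite ler_expR; lra.
have : expR x <= expR (2 * x ^+ 2) by rewrite ler_expR expr2; nra.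
lra.
Qed.

Context {Y : finType} {m : nat}.
Implicit Types (q : 'I_m -> Y -> R) (k : {ffun 'I_m -> Y}).

Definition prod_weight q k : R := \prod_j q j (k j).

Definition prod_prob q (E : pred {ffun 'I_m -> Y}) : R :=
  \sum_k prod_weight q k * (E k)%:R.

Lemma prod_weight_ge0 q k : (forall j y, 0 <= q j y) -> 0 <= prod_weight q k.
Proof. by move=> q0; apply: prodr_ge0. Qed.

Lemma prod_prob_ge0 q E : (forall j y, 0 <= q j y) -> 0 <= prod_prob q E.
Proof. by move=> q0; apply: sumr_ge0 => k _; rewrite mulr_ge0// prod_weight_ge0. Qed.

Lemma sum_prod_weight q :
  (forall j, \sum_y q j y = 1) -> \sum_k prod_weight q k = 1.
Proof.
by move=> q1; rewrite -(bigA_distr_bigA (fun j y => q j y)) big1.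
Qed.

Lemma prod_prob_le q (E F : pred {ffun 'I_m -> Y}) :
  (forall j y, 0 <= q j y) -> (forall k, E k -> F k) -> prod_prob q E <= prod_prob q F.
Proof.
move=> q0 EF; apply: ler_sum => k _; rewrite ler_wpM2l ?prod_weight_ge0//.
by rewrite ler_nat; have := EF k; case: (E k) => // /(_ isT) ->.
Qed.

Lemma prod_prob_compl q E : (forall j, \sum_y q j y = 1) ->
  prod_prob q (predC E) = 1 - prod_prob q E.
Proof.
move=> /sum_prod_weight <-; rewrite /prod_prob -sumrB; apply: eq_bigr => k _ /=.
by case: (E k); rewrite /= ?mulr1 ?mulr0 ?subrr ?subr0.
Qed.

Lemma prod_prob_union q I (r : seq I) (E : pred {ffun 'I_m -> Y})
    (F : I -> pred {ffun 'I_m -> Y}) :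
  (forall j y, 0 <= q j y) -> (forall k, E k -> has (fun i => F i k) r) ->
  prod_prob q E <= \sum_(i <- r) prod_prob q (F i).
Proof.
move=> q0 EF; rewrite /prod_prob exchange_big /=; apply: ler_sum => k _.
rewrite -mulr_sumr ler_wpM2l ?prod_weight_ge0// -natr_sum ler_nat.
have := EF k; case: (E k) => // /(_ isT).
elim: r {EF} => //= i r IH; rewrite big_cons.
by case: (F i k) => //= /IH; rewrite add0n.
Qed.

Lemma prod_prob_exp q (a : 'I_m -> Y -> R) (c : R)
    (E : pred {ffun 'I_m -> Y}) : (forall j y, 0 <= q j y) ->
  (forall k, E k -> c <= \sum_j a j (k j)) ->
  prod_prob q E <= expR (- c) * \prod_j \sum_y q j y * expR (a j y).
Proof.
move=> q0 Ec; rewrite bigA_distr_bigA mulr_sumr; apply: ler_sum => k _.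
rewrite big_split /= -expR_sum mulrCA -expRD ler_wpM2l ?prod_weight_ge0//.
have := Ec k; case: (E k) => [/(_ isT) h|_]; last exact: expR_ge0.
by rewrite -[leLHS]expR0 ler_expR addrC subr_ge0.
Qed.

End finite_products.

Section rademacher.
Context {R : realType} {m : nat}.

Definition fair (j : 'I_m) (b : bool) : R := 2^-1.

Definition signed_sum (v : 'I_m -> R) (sg : {ffun 'I_m -> bool}) : R :=
  \sum_j (-1) ^+ sg j * v j.

Lemma fair_ge0 j b : 0 <= fair j b.
Proof. by rewrite /fair invr_ge0. Qed.

Lemma fair_sum1 j : \sum_b fair j b = 1.
Proof. by rewrite big_bool /fair /=; lra. Qed.

(** The parameter [g] is left free instead of being optimized: in the chaining one value must serve
    all links of a given band and depth, whatever their variances. *)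
Lemma rademacher_upper_tail (v : 'I_m -> R) (g x : R) : 0 < g ->
  prod_prob fair (fun sg => 2 * g * (\sum_j v j ^+ 2) + x / g < signed_sum v sg)
    <= expR (- x).
Proof.
move=> g0.
pose c := 2 * g ^+ 2 * (\sum_j v j ^+ 2) + x.
have /(@prod_prob_exp R _ m fair (fun j b => g * ((-1) ^+ b * v j)) c) H :
    forall j b, 0 <= fair j b by exact: fair_ge0.
apply: (le_trans (H _ _)) => [sg|].
  rewrite -mulr_sumr -/(signed_sum v sg) /c => /ltW.
  rewrite -(ler_pM2l g0); apply: le_trans; rewrite mulrDr mulrC.
  by rewrite [g * (x / g)]mulrC divfK ?gt_eqF// expr2; lra.
apply: (@le_trans _ _ (expR (- c) * \prod_j expR (2 * (g * v j) ^+ 2))).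
  rewrite ler_wpM2l ?expR_ge0//; apply: ler_prod => j _.
  rewrite sumr_ge0/= => [|b _]; last by rewrite mulr_ge0 ?fair_ge0 ?expR_ge0.
  apply: le_trans (cosh_le_gaussian _).
  by rewrite big_bool /fair /= expr1 expr0 mul1r mulN1r mulrN; lra.
rewrite -expR_sum -expRD ler_expR /c -mulr_sumr.
under [X in _ + 2 * X <= _]eq_bigr do rewrite exprMn.
by rewrite -mulr_sumr; lra.
Qed.

Lemma rademacher_tail (v : 'I_m -> R) (g x : R) : 0 < g ->
  prod_prob fair (fun sg => 2 * g * (\sum_j v j ^+ 2) + x / g < `|signed_sum v sg|)
    <= 2 * expR (- x).
Proof.
move=> g0.
apply: (@le_trans _ _ (\sum_(b <- [:: true; false]) prod_prob fair (fun sg =>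
    2 * g * (\sum_j ((-1) ^+ b * v j) ^+ 2) + x / g <
    signed_sum (fun j => (-1) ^+ b * v j) sg))).
  apply: prod_prob_union => [|sg]; first exact: fair_ge0.
  have E (b : bool) : \sum_j ((-1) ^+ b * v j) ^+ 2 = \sum_j v j ^+ 2.
    by apply: eq_bigr => j _; rewrite exprMn sqrr_sign mul1r.
  have F (b : bool) :
      signed_sum (fun j => (-1) ^+ b * v j) sg = (-1) ^+ b * signed_sum v sg.
    by rewrite /signed_sum mulr_sumr; apply: eq_bigr => j _; rewrite mulrCA.
  move=> h; apply/hasP; exists (signed_sum v sg < 0).
    by case: (_ < _).
  by rewrite /= E F -normrEsign.
rewrite big_cons big_seq1 [leRHS]mulr_natl [leRHS]mulr2n.
by apply: lerD; apply: rademacher_upper_tail.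
Qed.

End rademacher.

Section concentration.
Context {R : realType} {Y : finType} {m : nat}.
Variables (q : 'I_m -> Y -> R) (a : Y -> R) (H : R).
Hypothesis q_ge0 : forall j y, 0 <= q j y.
Hypothesis q_sum1 : forall j, \sum_y q j y = 1.
Hypothesis a_le : forall y, 0 <= a y <= H.

Let mean j := \sum_y q j y * a y.
Let total := \sum_j mean j.

(** Bernstein's inequality: for values in [[0, H]] the variance is at most [H] times the mean, so
    the quadratic term is governed by [H * total]. *)
Lemma bounded_sum_tail_signed (b : bool) (g t : R) : 0 < g -> g * H <= 1 / 2 ->
  prod_prob q (fun k => t < (-1) ^+ b * (\sum_j a (k j) - total)) <=
    expR (- (g * t) + 2 * g ^+ 2 * (H * total)).
Proof.
move=> g0 gH; set e : R := (-1) ^+ b.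
have e2 : e ^+ 2 = 1 by rewrite /e sqrr_sign.
have eabs : `|e| = 1 by rewrite /e normr_sign.
have mean01 j : 0 <= mean j <= H.
  apply/andP; split.
    by apply: sumr_ge0 => y _; rewrite mulr_ge0// (andP (a_le y)).1.
  rewrite -[leRHS]mul1r -(q_sum1 j) mulr_suml; apply: ler_sum => y _.
  by rewrite ler_wpM2l// (andP (a_le y)).2.
have /(@prod_prob_exp R _ m q (fun j y => g * (e * (a y - mean j))) (g * t)) h :=
  q_ge0.
apply: (le_trans (h _ _)) => [k /ltW|].
  rewrite -(ler_pM2l g0) => /le_trans; apply.
  by rewrite -!mulr_sumr sumrB.
rewrite expRD ler_wpM2l ?expR_ge0//.
apply: (@le_trans _ _ (\prod_j expR (2 * g ^+ 2 * (H * mean j)))); last first.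
  by rewrite -expR_sum -!mulr_sumr.
apply: ler_prod => j _.
rewrite sumr_ge0/= => [|y _]; last by rewrite mulr_ge0 ?expR_ge0.
apply: le_trans (expR_ge1Dx _).
apply: (@le_trans _ _ (\sum_y q j y * (1 + g * (e * (a y - mean j))
    + 2 * (g * (e * (a y - mean j))) ^+ 2))).
  apply: ler_sum => y _; rewrite ler_wpM2l// expR_le_quadratic//.
  apply: le_trans (ler_norm _) _; rewrite !normrM eabs [1 * `|_|]mul1r gtr0_norm//.
  apply: le_trans gH; rewrite ler_wpM2l ?(ltW g0)// ler_norml.
  by have := a_le y; have := mean01 j; lra.
rewrite (eq_bigr (fun y => q j y + g * e * (q j y * a y) - g * e * mean j * q j y
    + 2 * g ^+ 2 * (q j y * (a y - mean j) ^+ 2))); last first.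
  move=> y _; rewrite !exprMn e2; ring.
rewrite !big_split /= sumrN -!mulr_sumr q_sum1 -/(mean j) mulr1 addrK.
rewrite lerD2l ler_wpM2l ?mulr_ge0 ?(ltW g0)//.
rewrite (eq_bigr (fun y => q j y * a y ^+ 2 - 2 * mean j * (q j y * a y)
    + mean j ^+ 2 * q j y)); last by move=> y _; ring.
rewrite !big_split /= sumrN -!mulr_sumr q_sum1 -/(mean j).
apply: (@le_trans _ _ (\sum_y q j y * a y ^+ 2)).
  by have := sqr_ge0 (mean j); rewrite !expr2; lra.
rewrite /mean mulr_sumr; apply: ler_sum => y _.
rewrite [leRHS]mulrCA ler_wpM2l// expr2.
by have /andP[? ?] := a_le y; rewrite ler_wpM2r.
Qed.

Lemma bounded_sum_tail (g t : R) : 0 < g -> g * H <= 1 / 2 ->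
  prod_prob q (fun k => t < `|\sum_j a (k j) - total|) <=
    2 * expR (- (g * t) + 2 * g ^+ 2 * (H * total)).
Proof.
move=> g0 gH.
apply: (@le_trans _ _ (\sum_(b <- [:: true; false]) prod_prob q (fun k =>
    t < (-1) ^+ b * (\sum_j a (k j) - total)))).
  apply: prod_prob_union => // k.
  move=> h; apply/hasP; exists (\sum_j a (k j) - total < 0).
    by case: (_ < _).
  by rewrite -normrEsign.
rewrite big_cons big_seq1 [leRHS]mulr_natl [leRHS]mulr2n.
by apply: lerD; apply: bounded_sum_tail_signed.
Qed.

End concentration.

(** * Counting words and geometric sums *)

Section bounded_words.
Context {R : realType} {A : finType}.

Fixpoint words (n : nat) : seq (seq A) :=
  if n is n'.+1 then [::] :: [seq a :: c | a <- enum A, c <- words n']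
  else [:: [::]].

Lemma mem_words n (c : seq A) : (size c <= n)%N -> c \in words n.
Proof.
elim: n c => [|n IH] [|a c] //=.
rewrite ltnS => /IH cn; rewrite inE; apply/orP; right.
by apply/allpairsP; exists (a, c); rewrite /= mem_enum.
Qed.

Lemma sum_words_le n (x : R) : 0 <= x -> #|A|%:R * x <= 1 / 2 ->
  \sum_(c <- words n) x ^+ size c <= 2.
Proof.
move=> x0 Ax; elim: n => [|n IH] /=; first by rewrite big_seq1 expr0; lra.
rewrite big_cons expr0 big_allpairs_dep /= big_enum /=.
rewrite (eq_bigr (fun=> x * \sum_(c <- words n) x ^+ size c)); last first.
  by move=> a _; rewrite mulr_sumr; apply: eq_bigr => c _; rewrite exprS.
rewrite sumr_const -[X in 1 + X <= _]mulr_natl mulrA.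
have : #|A|%:R * x * (\sum_(c <- words n) x ^+ size c) <= 1 / 2 * 2.
  rewrite ler_pM// ?mulr_ge0//.
  by apply: sumr_ge0 => c _; rewrite exprn_ge0.
lra.
Qed.

Lemma sum_geometric_le n (x : R) : 0 <= x <= 1 / 2 -> \sum_(i < n) x ^+ i <= 2.
Proof.
move=> /andP[x0 x12].
suff : \sum_(i < n) x ^+ i + 2 * x ^+ n <= 2.
  by have := exprn_ge0 n x0; lra.
elim: n => [|n IH]; first by rewrite big_ord0 expr0; lra.
rewrite big_ord_recr /= exprS.
have : 0 <= x ^+ n by rewrite exprn_ge0.
nra.
Qed.

Lemma sum_geometric_top_le n (x : R) : 1 < x ->
  \sum_(d < n.+1) x ^+ d / x ^+ n <= x / (x - 1).
Proof.
move=> x1; have x0 : 0 < x by lra.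
elim: n => [|n IH].
  by rewrite big_ord1 expr0 divr1 ler_pdivlMr; lra.
rewrite big_ord_recr /= divff ?expf_eq0 ?gt_eqF//=.
rewrite (eq_bigr (fun d : 'I_n.+1 => x ^+ d / x ^+ n / x)); last first.
  by move=> d _; rewrite [x ^+ n.+1]exprS invfM mulrA mulrAC.
rewrite -mulr_suml.
have -> : x / (x - 1) = x / (x - 1) / x + 1.
  by field; rewrite !gt_eqF//; lra.
by rewrite lerD2r ler_pM2r ?invr_gt0.
Qed.

End bounded_words.

(** * Dyadic bands and chaining *)

Section bands.
Context {R : realType}.
Variables (p : R) (n : nat) (t : nat -> R).
Hypothesis pn : 1 <= p <= n%:R.
Hypothesis t_gt0 : forall i, 0 < t i.
Hypothesis t_half : forall i, t i.+1 = t i / 2.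

(** The lower cut is [2 * t j] and not [t j]: when [r < t j], every approximant within [t j] of [r]
    still lies below the cut and has band value zero, so only values [r >= t j] contribute to the
    increments. *)
Definition band j (r : R) : R := Num.min r (4 * t j) `^ p - Num.min r (2 * t j) `^ p.

Let p0 : 0 < p.
Proof. by have /andP[? _] := pn; lra. Qed.

Lemma scale_powR j d : t j `^ p = t (j + d)%N `^ p * (2 `^ p) ^+ d.
Proof.
elim: d => [|d ->]; first by rewrite addn0 expr0 mulr1.
rewrite addnS t_half powRM ?(ltW (t_gt0 _))// exprS mulrA -(mulrA (_ `^ p)).
by rewrite -powRM// mulVf// powR1 mulr1.
Qed.

Lemma band_telescope J r : 0 <= r <= 4 * t 0%N ->
  r `^ p = \sum_(j < J) band j r + Num.min r (4 * t J) `^ p.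
Proof.
move=> /andP[r0 rt]; elim: J => [|J IH].
  by rewrite big_ord0 add0r min_l.
rewrite big_ord_recr /= /band t_half IH.
rewrite (_ : 4 * (t J / 2) = 2 * t J); last by field.
by ring.
Qed.

Lemma min_powR_lipschitz (x y s : R) : 0 <= x -> 0 <= y -> 0 <= s ->
  `|Num.min x s `^ p - Num.min y s `^ p| <= n%:R * s `^ (p - 1) * `|x - y|.
Proof.
wlog xy : x y / x <= y.
  move=> hw x0 y0 s0; have [xy|yx] := leP x y; first exact: hw.
  by rewrite distrC [`|x - y|]distrC; apply: hw => //; exact: ltW.
move=> x0 y0 s0.
have m0 : 0 <= Num.min x s by rewrite le_min x0.
have mxy : Num.min x s <= Num.min y s by rewrite le_min !ge_min xy lexx orbT.
have d : Num.min y s - Num.min x s <= y - x.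
  by case: (leP x s) => ?; case: (leP y s) => ?; lra.
rewrite distrC [`|x - y|]distrC ger0_norm ?subr_ge0 ?ler_powR2 ?(ltW p0)//.
rewrite [`|y - x|]ger0_norm ?subr_ge0//.
apply: (le_trans (powR_lipschitz pn (s := s) _ _)); first by rewrite m0.
  by rewrite ge_min lexx orbT.
by rewrite ler_wpM2l// mulr_ge0 ?powR_ge0.
Qed.

Lemma band_lipschitz j (x y : R) : 0 <= x -> 0 <= y ->
  `|band j x - band j y| <= 2 * n%:R * (4 * t j) `^ (p - 1) * `|x - y|.
Proof.
move=> x0 y0; rewrite /band.
have := min_powR_lipschitz x0 y0 (ltW (mulr_gt0 (ltr0n R 4) (t_gt0 j))).
have := min_powR_lipschitz x0 y0 (ltW (mulr_gt0 (ltr0n R 2) (t_gt0 j))).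
have : n%:R * (2 * t j) `^ (p - 1) * `|x - y| <=
       n%:R * (4 * t j) `^ (p - 1) * `|x - y|.
  rewrite ler_wpM2r// ler_wpM2l// ler_powR2//; have /andP[? _] := pn;
    by have := t_gt0 j; lra.
move=> h h2 h4.
have -> (A B C E : R) : A - B - (C - E) = (A - C) - (B - E) by ring.
by apply: (le_trans (ler_normB _ _)); lra.
Qed.

Lemma band_small j (x : R) : x <= 2 * t j -> band j x = 0.
Proof. by move=> x2; rewrite /band !min_l ?subrr//; have := t_gt0 j; lra. Qed.

Lemma band_bounds j (x : R) : 0 <= x -> 0 <= band j x <= (4 * t j) `^ p.
Proof.
move=> x0; have tj := t_gt0 j; apply/andP; split.
  rewrite subr_ge0 ler_powR2 ?(ltW p0)//; first by rewrite le_min x0; lra.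
  by rewrite le_min !ge_min lexx /=; apply/orP; right; lra.
have := powR_ge0 (Num.min x (2 * t j)) p.
have : Num.min x (4 * t j) `^ p <= (4 * t j) `^ p.
  by rewrite ler_powR2 ?(ltW p0)// ?le_min ?ge_min ?lexx ?orbT ?x0//=; lra.
rewrite /band; lra.
Qed.

(** Brings the band counts back to the [p]-th moment: [t j ^ p <= 2 * (t j ^ p - t j.+1 ^ p)]
    because the scales halve, and the differences telescope. *)
Lemma sum_scales_le J (r : R) : 0 <= r ->
  \sum_(j < J) t j `^ p * (t j <= r)%R%:R <= 2 * r `^ p.
Proof.
move=> r0.
suff : \sum_(j < J) t j `^ p * (t j <= r)%R%:R <=
    \sum_(j < J) 2 * (Num.min r (t j) `^ p - Num.min r (t j.+1) `^ p).
  move=> /le_trans; apply; rewrite -mulr_sumr ler_wpM2l//.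
  suff : \sum_(j < J) (Num.min r (t j) `^ p - Num.min r (t j.+1) `^ p) <=
      Num.min r (t 0%N) `^ p - Num.min r (t J) `^ p.
    move=> /le_trans; apply.
    have : Num.min r (t 0%N) `^ p <= r `^ p.
      by apply: ler_powR2; rewrite ?(ltW p0) ?le_min ?ge_min ?lexx ?r0 ?(ltW (t_gt0 _)).
    by have := powR_ge0 (Num.min r (t J)) p; lra.
  elim: J => [|J IH]; first by rewrite big_ord0 subrr.
  by rewrite big_ord_recr /=; lra.
apply: ler_sum => j _.
have tj := t_gt0 j; have tj1 := t_gt0 j.+1.
case: (leP (t j) r) => tr; last first.
  rewrite mulr0; apply: mulr_ge0 => //; rewrite subr_ge0.
  apply: ler_powR2; rewrite ?(ltW p0)//; first by rewrite le_min r0 ltW.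
  by rewrite ge_min lexx.
rewrite mulr1 min_r; last by rewrite t_half; lra.
rewrite t_half.
by have /andP[p1 _] := pn; have := powR_half_le p1 (ltW tj); lra.
Qed.

(** The Lipschitz constant [2 * n * (4 * t j) ^ (p - 1)] of a band times the link length
    [3 / 2 * t j], divided by [t j ^ p]; the 3/2 adds the errors of two consecutive approximants. *)
Definition increment_const : R := 3 * n%:R * 4 `^ (p - 1).

Let band_increment j d (x y r : R) : 0 <= x -> 0 <= y -> 0 <= r ->
  `|x - r| <= t j -> `|y - r| <= t j -> `|x - y| <= 3 / 2 / 2 ^+ d * t j ->
  `|band j x - band j y| <= increment_const / 2 ^+ d * t j `^ p * (t j <= r)%R%:R.
Proof.
move=> x0 y0 r0 xr yr xy.
have [tr|tr] := leP (t j) r; last first.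
  have -> : band j x = 0 by apply: band_small; move: xr; rewrite ler_norml; lra.
  have -> : band j y = 0 by apply: band_small; move: yr; rewrite ler_norml; lra.
  by rewrite subrr normr0 mulr0.
rewrite mulr1; apply: (le_trans (band_lipschitz j x0 y0)).
have c0 : 0 <= 2 * n%:R * (4 * t j) `^ (p - 1) by rewrite !mulr_ge0 ?powR_ge0.
apply: (le_trans (ler_wpM2l c0 xy)).
rewrite -(mulr_powRB1 (ltW (t_gt0 j)) p0) powRM ?(ltW (t_gt0 j))//.
rewrite /increment_const le_eqVlt; apply/orP; left; apply/eqP.
by field; rewrite expf_neq0.
Qed.

(* [a k] approximates [r] at scale [t (j + k.+1)]. *)
Lemma band_chain_increment j d (a : nat -> R) (r : R) :
  (forall k, 0 <= a k) -> 0 <= r -> (forall k, `|a k - r| <= t (j + k.+1)%N) ->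
  `|band j (a d.+1) - band j (a d)| <=
    increment_const / 2 ^+ d.+1 * t j `^ p * (t j <= r)%R%:R.
Proof.
move=> a0 r0 ar.
have tk k : t (j + k)%N = t j / 2 ^+ k.
  elim: k => [|k IH]; first by rewrite addn0 expr0 divr1.
  by rewrite addnS t_half IH exprS invfM mulrA mulrAC.
have tle k : t (j + k)%N <= t j.
  rewrite tk ler_pdivrMr ?exprn_gt0// ler_peMr ?(ltW (t_gt0 _))//.
  by rewrite exprn_ege1//; lra.
apply: band_increment => //; [exact: le_trans (ar _) (tle _)..|].
have := ler_normB (a d.+1 - r) (a d - r).
rewrite opprB addrA subrK => /le_trans; apply.
have := ar d; have := ar d.+1; rewrite !tk ![2 ^+ _.+1]exprS !invfM.
lra.
Qed.

Lemma band_chain_end j d (x r : R) : 0 <= x -> 0 <= r ->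
  `|x - r| <= t (j + d.+1)%N ->
  `|band j r - band j x| <= increment_const / 2 ^+ d * t j `^ p * (t j <= r)%R%:R.
Proof.
move=> x0 r0 xr.
have tk k : t (j + k)%N = t j / 2 ^+ k.
  elim: k => [|k IH]; first by rewrite addn0 expr0 divr1.
  by rewrite addnS t_half IH exprS invfM mulrA mulrAC.
have tle k : t (j + k)%N <= t j.
  rewrite tk ler_pdivrMr ?exprn_gt0// ler_peMr ?(ltW (t_gt0 _))//.
  by rewrite exprn_ege1//; lra.
have tj := t_gt0 j.
apply: band_increment => //; rewrite ?subrr ?normr0 ?(ltW tj)//.
  exact: le_trans xr (tle _).
rewrite distrC; apply: (le_trans xr); rewrite tk exprS invfM mulrCA mulrA.
rewrite mulrAC ler_wpM2r ?(ltW tj)// ler_wpM2r ?invr_ge0 ?exprn_ge0//; lra.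
Qed.

(** The first link starts from zero, so no small difference is available; the height
    [4 ^ p * t j ^ p] of the band fits under the constant because [4 <= 3 * n]. *)
Lemma band_chain_start j (x r : R) : (1 < n)%N -> 0 <= x -> 0 <= r ->
  `|x - r| <= t j.+1 ->
  `|band j x| <= increment_const / 2 ^+ 0 * t j `^ p * (t j <= r)%R%:R.
Proof.
move=> n1 x0 r0 xr; have tj := t_gt0 j.
have [tr|tr] := leP (t j) r; last first.
  rewrite band_small ?normr0 ?mulr0//.
  by move: xr; rewrite ler_norml t_half; lra.
rewrite mulr1 expr0 divr1.
have /andP[b0 b4] := band_bounds j x0.
rewrite ger0_norm//; apply: (le_trans b4).
rewrite powRM ?(ltW tj)// ler_wpM2r ?powR_ge0//.
rewrite -(@mulr_powRB1 _ 4 p)// /increment_const ler_wpM2r ?powR_ge0//.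
have : 2 <= n%:R :> R by rewrite ler_nat.
lra.
Qed.

End bands.

Lemma sum_allpairs_mul {R : realType} {S T : Type} (F : S -> R) (G : T -> R)
    (r : seq S) (s : seq T) :
  \sum_(w <- [seq (x, y) | x <- r, y <- s]) F w.1 * G w.2 =
  (\sum_(x <- r) F x) * \sum_(y <- s) G y.
Proof.
rewrite big_allpairs_dep /= mulr_suml.
by apply: eq_bigr => x _; rewrite mulr_sumr.
Qed.

Section rademacher_chaining.
Context {R : realType} {C Y : finType} {m : nat}.
Variables (p : R) (n : nat) (t : nat -> R) (vals : seq C -> Y -> R).
Variables (y y' : 'I_m -> Y) (fam : set (Y -> R)).
Variables (U K G eps : R) (q J : nat).
Hypothesis pn : 1 <= p <= n%:R.
Hypothesis n_gt1 : (1 < n)%N.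
Hypothesis t_gt0 : forall i, 0 < t i.
Hypothesis t_half : forall i, t i.+1 = t i / 2.
Hypothesis vals_ge0 : forall c x, 0 <= vals c x.
Hypothesis eps_gt0 : 0 < eps.
Hypothesis U_gt0 : 0 < U.
Hypothesis U_entropy : #|C|%:R * expR (- U) <= 1 / 2.
Hypothesis U_half : expR (- U) <= 1 / 2.
Hypothesis G_gt1 : 1 < G.
Hypothesis GE : 4 * G ^+ 2 = 2 `^ p.
Hypothesis fam_bound : forall r, fam r -> forall x, 0 <= r x <= 4 * t 0%N.
Hypothesis fam_code : forall r, fam r -> exists c : nat -> seq C,
  [/\ forall i x, `|vals (c i) x - r x| <= t i,
      forall i, (i <= size (c i))%N,
      forall i, (size (c i) <= size (c i.+1))%N &
      forall N, \sum_(i < N) (size (c i))%:R * t i `^ p <= K].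

Let p0 : 0 < p.
Proof. by have /andP[? _] := pn; lra. Qed.

Let G0 : 0 < G.
Proof. by have := G_gt1; lra. Qed.

Implicit Types (a b : Y -> R) (sg : {ffun 'I_m -> bool}).

Definition pair_sum a : R := \sum_j (a (y j) + a (y' j)).

Definition pair_disc sg a : R := signed_sum (fun j => a (y j) - a (y' j)) sg.

Let opt_val (o : option (seq C)) x := if o is Some c then vals c x else 0.

Let opt_size (o : option (seq C)) := if o is Some c then size c else 0%N.

Let link j (co : seq C * option (seq C)) x :=
  band p t j (vals co.1 x) - band p t j (opt_val co.2 x).

(* The Chernoff parameter: since [4 * G ^+ 2 = 2 `^ p], the weight [4 ^+ d * G ^+ d]
   makes both terms of the bound in [bad] geometric in [d], growing like
   [G ^+ d / G ^+ q] after the entropy estimate is inserted. *)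
Let tilt j d := eps * 4 ^+ d * G ^+ d / (G ^+ q * t j `^ p).

(** The indices [j] and [d] are charged besides the word lengths, so that the sum over all links is
    bounded uniformly in [J] and [q]; the final 1 keeps a factor [exp (- U)]. *)
Let cost j d (co : seq C * option (seq C)) : R :=
  U * (size co.1 + opt_size co.2 + j + d + 1)%N%:R.

Let bad j d co sg := 2 * tilt j d *
    (\sum_i (link j co (y i) - link j co (y' i)) ^+ 2) + cost j d co / tilt j d
  < `|pair_disc sg (link j co)|.

Lemma pair_sum_le a b : (forall x, a x <= b x) -> pair_sum a <= pair_sum b.
Proof. by move=> ab; apply: ler_sum => j _; exact: lerD. Qed.

Lemma pair_sum_ge0 a : (forall x, 0 <= a x) -> 0 <= pair_sum a.
Proof. by move=> a0; apply: sumr_ge0 => j _; exact: addr_ge0. Qed.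

Lemma pair_sumZ (k : R) a : pair_sum (fun x => k * a x) = k * pair_sum a.
Proof. by rewrite /pair_sum mulr_sumr; apply: eq_bigr => j _; rewrite mulrDr. Qed.

Lemma pair_sum_sum N (F : nat -> Y -> R) :
  pair_sum (fun x => \sum_(i < N) F i x) = \sum_(i < N) pair_sum (F i).
Proof.
rewrite /pair_sum exchange_big; apply: eq_bigr => j _ /=.
by rewrite big_split.
Qed.

Lemma pair_discD sg a b :
  pair_disc sg (fun x => a x + b x) = pair_disc sg a + pair_disc sg b.
Proof.
rewrite /pair_disc /signed_sum -big_split /=; apply: eq_bigr => j _.
by rewrite -mulrDr; congr (_ * _); ring.
Qed.

Lemma pair_disc_sum sg N (F : nat -> Y -> R) :
  pair_disc sg (fun x => \sum_(i < N) F i x) = \sum_(i < N) pair_disc sg (F i).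
Proof.
elim: N => [|N IH].
  rewrite big_ord0 /pair_disc /signed_sum big1// => j _.
  by rewrite !big_ord0 subrr mulr0.
rewrite big_ord_recr /= -IH -pair_discD; congr pair_disc.
by apply/funext => x; rewrite big_ord_recr.
Qed.

Lemma eq_pair_disc sg a b : a =1 b -> pair_disc sg a = pair_disc sg b.
Proof. by move=> /funext ->. Qed.

Lemma pair_disc_le sg a b : (forall x, `|a x| <= b x) ->
  `|pair_disc sg a| <= pair_sum b.
Proof.
move=> ab; apply: le_trans (ler_norm_sum _ _ _) _; apply: ler_sum => j _.
rewrite normrM normr_sign mul1r; apply: (le_trans (ler_normB _ _)).
exact: lerD.
Qed.

Lemma pair_disc_sqr_le a b : (forall x, `|a x| <= b x) ->
  \sum_i (a (y i) - a (y' i)) ^+ 2 <= 2 * pair_sum (fun x => b x ^+ 2).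
Proof.
move=> ab; rewrite mulr_sumr; apply: ler_sum => i _.
have sq x : a x ^+ 2 <= b x ^+ 2.
  by rewrite -real_normK ?num_real// ler_sqr ?nnegrE// (le_trans _ (ab x)).
have := sq (y i); have := sq (y' i); have := sqr_ge0 (a (y i) + a (y' i)).
by rewrite !expr2; nra.
Qed.

Let tilt_gt0 j d : 0 < tilt j d.
Proof.
by rewrite /tilt divr_gt0// !mulr_gt0// ?exprn_gt0// powR_gt0.
Qed.

Let bad_prob j d co : prod_prob fair (bad j d co) <= 2 * expR (- cost j d co).
Proof. exact: rademacher_tail. Qed.

(** The word bound [S] only keeps the list finite; the estimate of its total probability is uniform
    in [S]. *)
Let bad_list S : seq ((nat * nat) * (seq C * option (seq C))) :=
  [seq (jd, co) | jd <- [seq (j, d) | j <- iota 0 J, d <- iota 0 q.+1],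
                  co <- [seq (c, o) | c <- words S, o <- None :: map Some (words S)]].

Let sum_iota_le N : \sum_(j <- iota 0 N) expR (- U) ^+ j <= 2.
Proof.
have -> : iota 0 N = index_iota 0 N by rewrite /index_iota subn0.
rewrite big_mkord sum_geometric_le// expR_ge0/=; exact: U_half.
Qed.

(** The constant is 2 for the two-sided tail, [2 * 2] for the sums over [j] and [d], 2 for the first
    word and [1 + 2] for the optional second one. *)
Let bad_total S :
  \sum_(w <- bad_list S) prod_prob fair (bad w.1.1 w.1.2 w.2) <= 48 * expR (- U).
Proof.
pose z := expR (- U); have z0 : 0 <= z by exact: expR_ge0.
apply: (@le_trans _ _ (\sum_(w <- bad_list S) 2 * z * (z ^+ w.1.1 *
    z ^+ w.1.2 * (z ^+ size w.2.1 * z ^+ opt_size w.2.2)))).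
  apply: ler_sum => w _; apply: (le_trans (bad_prob _ _ _)).
  rewrite -mulrA ler_wpM2l// /cost mulrC -mulrN expRM_natl -/z.
  by rewrite !exprD expr1 le_eqVlt; apply/orP; left; apply/eqP; ring.
rewrite -mulr_sumr /bad_list.
rewrite (sum_allpairs_mul (fun jd => z ^+ jd.1 * z ^+ jd.2)
  (fun co => z ^+ size co.1 * z ^+ opt_size co.2)).
rewrite (sum_allpairs_mul (fun j => z ^+ j) (fun d => z ^+ d)).
rewrite (sum_allpairs_mul (fun c => z ^+ size c) (fun o => z ^+ opt_size o)).
rewrite [X in _ * (_ * (_ * X))]big_cons big_map expr0.
set a := \sum_(j <- iota 0 J) _; set b := \sum_(j <- iota 0 q.+1) _.
set c := \sum_(_ <- _) _.
have a2 : a <= 2 by exact: sum_iota_le.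
have b2 : b <= 2 by exact: sum_iota_le.
have c2 : c <= 2 by apply: sum_words_le => //; exact: U_entropy.
have a0 : 0 <= a by apply: sumr_ge0 => ? _; exact: exprn_ge0.
have b0 : 0 <= b by apply: sumr_ge0 => ? _; exact: exprn_ge0.
have c0 : 0 <= c by apply: sumr_ge0 => ? _; exact: exprn_ge0.
have ab : a * b <= 2 * 2 by exact: ler_pM.
have cc : c * (1 + c) <= 2 * 3 by apply: ler_pM => //; lra.
have : a * b * (c * (1 + c)) <= 2 * 2 * (2 * 3).
  by apply: ler_pM => //; apply: mulr_ge0 => //; lra.
rewrite -/z; nra.
Qed.

Definition chaining_slope : R :=
  8 * eps * increment_const p n ^+ 2 * (G / (G - 1)) +
  2 * (increment_const p n / 2 ^+ q).

Definition chaining_offset : R :=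
  12 * U * G ^+ 2 * (G ^+ q) ^+ 2 * (G / (G - 1)) * K / eps.

Definition chaining_bound (r : Y -> R) : R :=
  chaining_slope * pair_sum (fun x => r x `^ p) +
  2 * m%:R * (4 * t J) `^ p + chaining_offset.

(** The deterministic half: once no link is bad, the triangle inequality along the chains bounds
    every member of the family. *)
Let chaining_det S sg r : fam r ->
  (forall c : nat -> seq C, (forall N, \sum_(i < N) (size (c i))%:R * t i `^ p <= K) ->
     forall i, (i <= J + q)%N -> (size (c i) <= S)%N) ->
  (forall w, w \in bad_list S -> ~~ bad w.1.1 w.1.2 w.2 sg) ->
  `|pair_disc sg (fun x => r x `^ p)| <= chaining_bound r.
Proof.
move=> fr cS good.
have [c [cr isz szmono csum]] := fam_code fr.
have r0 x : 0 <= r x by have /andP[] := fam_bound fr x.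
pose ap j k x := vals (c (j + k.+1)%N) x.
pose ind j x : R := (t j <= r x)%R%:R.
pose lk j d := (c (j + d.+1)%N, if d is d'.+1 then Some (c (j + d)%N) else None).
pose T := pair_sum (fun x => r x `^ p).
have ind2 j x : ind j x ^+ 2 = ind j x.
  by rewrite /ind; case: (_ <= _); rewrite ?expr1n ?expr0n.
have apr j k x : `|ap j k x - r x| <= t (j + k.+1)%N by exact: cr.
have band0 j : band p t j 0 = 0.
  by apply: band_small => //; have := t_gt0 j; lra.
have tele j D x : \sum_(d < D.+1) link j (lk j d) x = band p t j (ap j D x).
  elim: D => [|D IH]; first by rewrite big_ord1 /link /= band0 subr0.
  by rewrite big_ord_recr /= IH /link /= addrC subrK.
have decomp : pair_disc sg (fun x => r x `^ p) =
    \sum_(j < J) (\sum_(d < q.+1) pair_disc sg (link j (lk j d)) +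
      pair_disc sg (fun x => band p t j (r x) - band p t j (ap j q x))) +
    pair_disc sg (fun x => Num.min (r x) (4 * t J) `^ p).
  pose F j x := \sum_(d < q.+1) link j (lk j d) x +
                (band p t j (r x) - band p t j (ap j q x)).
  rewrite (@eq_pair_disc sg _ (fun x => \sum_(j < J) F j x +
      Num.min (r x) (4 * t J) `^ p)); last first.
    move=> x; rewrite (band_telescope p t_half J (fam_bound fr x)).
    congr (_ + _); apply: eq_bigr => j _.
    by rewrite /F tele addrC subrK.
  rewrite pair_discD pair_disc_sum; congr (_ + _); apply: eq_bigr => j _.
  rewrite /F [LHS]pair_discD; congr (_ + _).
  exact: (pair_disc_sum sg q.+1 (fun d => link j (lk j d))).
pose k1 := increment_const p n.
have k1_ge0 : 0 <= k1 by rewrite /k1 /increment_const !mulr_ge0 ?powR_ge0.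
pose wt d := G ^+ d / G ^+ q.
have Gn d : 0 < G ^+ d by rewrite exprn_gt0.
have wt_gt0 d : 0 < wt d by rewrite divr_gt0.
have tau0 j : 0 < t j `^ p by rewrite powR_gt0.
pose nn j := pair_sum (ind j).
have nn0 j : 0 <= nn j by apply: pair_sum_ge0 => x; exact: ler0n.
have sum_nn : \sum_(j < J) t j `^ p * nn j <= 2 * T.
  rewrite (eq_bigr (fun j : 'I_J => pair_sum (fun x => t j `^ p * ind j x))).
    rewrite -(pair_sum_sum J (fun j x => t j `^ p * ind j x)) -pair_sumZ.
    by apply: pair_sum_le => x; exact: (sum_scales_le pn t_gt0 t_half).
  by move=> j _; rewrite pair_sumZ.
have link_le j d x : `|link j (lk j d) x| <= k1 / 2 ^+ d * t j `^ p * ind j x.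
  case: d => [|d].
    rewrite /link /= band0 subr0.
    apply: (band_chain_start pn t_gt0 t_half) => //.
    by have := apr j 0%N x; rewrite /ap addn1.
  have := @band_chain_increment _ p n t pn t_gt0 t_half j d
            (fun k => ap j k x) (r x).
  by apply => // k; rewrite /ap.
have link_disc j d : (j < J)%N -> (d <= q)%N ->
    `|pair_disc sg (link j (lk j d))| <=
    4 * eps * k1 ^+ 2 * wt d * (t j `^ p * nn j) +
    12 * U * G ^+ 2 * (G ^+ q) ^+ 2 / eps * wt d *
      ((size (c (j + d.+1)%N))%:R * t (j + d.+1)%N `^ p).
  move=> jJ dq.
  have iS i : (i <= J + q)%N -> (size (c i) <= S)%N by exact: cS.
  have mem : ((j, d), lk j d) \in bad_list S.
    rewrite /bad_list; apply: (@allpairs_f _ _ _ pair).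
      by apply: (@allpairs_f _ _ _ pair); rewrite mem_iota add0n.
    rewrite /lk; apply: (@allpairs_f _ _ _ pair).
      by rewrite mem_words// iS// addnS -addSn leq_add.
    case: d dq => [|d] dq; first by rewrite inE.
    rewrite inE; apply/orP; right; apply: map_f; apply: mem_words.
    by rewrite iS// leq_add// ltnW.
  have := good _ mem; rewrite -leNgt => /le_trans; apply; rewrite /=.
  apply: lerD.
    apply: (@le_trans _ _ (2 * tilt j d * (2 * pair_sum (fun x =>
        (k1 / 2 ^+ d * t j `^ p * ind j x) ^+ 2)))).
      rewrite ler_wpM2l//; first by rewrite mulr_ge0// ltW.
      exact: pair_disc_sqr_le.
    have -> : (fun x => (k1 / 2 ^+ d * t j `^ p * ind j x) ^+ 2) =
        (fun x => (k1 / 2 ^+ d * t j `^ p) ^+ 2 * ind j x).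
      by apply/funext => x; rewrite exprMn ind2.
    rewrite pair_sumZ -/(nn j) le_eqVlt; apply/orP; left; apply/eqP.
    have E4 : 4 ^+ d = (2 ^+ d) ^+ 2 :> R.
      by rewrite -exprM mulnC exprM; congr (_ ^+ _); ring.
    rewrite /tilt E4 /wt.
    have : 2 ^+ d != 0 :> R by rewrite expf_neq0.
    have := lt0r_neq0 (Gn q); have := lt0r_neq0 (tau0 j).
    move: (2 ^+ d) (G ^+ q) (t j `^ p) (G ^+ d) => e2 eq tj ed h1 h2 h3.
    by field; rewrite h1 h2 h3.
  have si : (j + d.+1 <= size (c (j + d.+1)%N))%N by exact: isz.
  (* Both words have length at most [size (c (j + d.+1))], and so does the index [j + d + 1],
     because a code has at least as many symbols as its scale index; hence the factor 3. *)
  have cost_le : cost j d (lk j d) <= U * (3 * (size (c (j + d.+1)%N))%:R).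
    rewrite /cost ler_wpM2l ?(ltW U_gt0)// -natrM ler_nat.
    rewrite -!addnA addn1 mulSn mulSn mul1n leq_add2l leq_add//=.
    by case: d {dq mem} si => [|d] _ //=; rewrite [in leqRHS]addnS.
  apply: (@le_trans _ _ (U * (3 * (size (c (j + d.+1)%N))%:R) / tilt j d)).
    by rewrite ler_wpM2r// invr_ge0 ltW.
  (* Moving from [t j] to the finer scale costs [(4 * G ^+ 2) ^+ d.+1]; the tilt cancels
     [4 ^+ d * G ^+ d] of this, and a growth of [G ^+ d] remains. *)
  rewrite /tilt (scale_powR p t_gt0 t_half j d.+1) -GE.
  have G2 : (4 * G ^+ 2) ^+ d = 4 ^+ d * (G ^+ d) ^+ 2.
    by rewrite exprMn -!exprM mulnC.
  rewrite exprS G2 /wt.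
  have := tau0 (j + d.+1)%N; have := Gn d; have := Gn q.
  have : 0 < 4 ^+ d :> R by rewrite exprn_gt0.
  move: (4 ^+ d) (G ^+ q) (G ^+ d) (t _ `^ p) => e4 eq ed tj.
  move=> /lt0r_neq0 h1 /lt0r_neq0 h2 /lt0r_neq0 h3 /lt0r_neq0 h4.
  rewrite le_eqVlt; apply/orP; left; apply/eqP.
  by field; rewrite h1 h2 h3 h4 !gt_eqF.
have end_disc j : `|pair_disc sg
      (fun x => band p t j (r x) - band p t j (ap j q x))| <=
    k1 / 2 ^+ q * (t j `^ p * nn j).
  rewrite mulrA -pair_sumZ; apply: pair_disc_le => x.
  by apply: (band_chain_end pn t_gt0 t_half) => //; rewrite /ap.
have low_disc : `|pair_disc sg (fun x => Num.min (r x) (4 * t J) `^ p)| <=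
    2 * m%:R * (4 * t J) `^ p.
  have -> : 2 * m%:R * (4 * t J) `^ p = pair_sum (fun=> (4 * t J) `^ p).
    rewrite /pair_sum sumr_const card_ord -[RHS]mulr_natl; ring.
  apply: pair_disc_le => x; rewrite ger0_norm ?powR_ge0//.
  apply: ler_powR2; rewrite ?(ltW p0)// ?ge_min ?lexx ?orbT//.
  by rewrite le_min r0 mulr_ge0// ltW.
have csum' d : \sum_(j < J) (size (c (j + d.+1)%N))%:R * t (j + d.+1)%N `^ p <= K.
  apply: le_trans (csum (J + d.+1)%N).
  pose F i := (size (c i))%:R * t i `^ p.
  have F0 i : 0 <= F i by rewrite mulr_ge0// ltW.
  have E : \sum_(d.+1 <= i < J + d.+1) F i = \sum_(j < J) F (j + d.+1)%N.
    by rewrite -{1}[d.+1]add0n big_addn addnK big_mkord.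
  rewrite -/(\sum_(j < J) F (j + d.+1)%N) -E.
  rewrite -(big_mkord xpredT F).
  rewrite [leRHS](big_cat_nat (n := d.+1)) ?leq_addl//=.
  by rewrite lerDr sumr_ge0.
rewrite decomp; apply: (le_trans (ler_normD _ _)).
apply: (@le_trans _ _ (\sum_(j < J) (\sum_(d < q.+1)
    (4 * eps * k1 ^+ 2 * wt d * (t j `^ p * nn j) +
     12 * U * G ^+ 2 * (G ^+ q) ^+ 2 / eps * wt d *
      ((size (c (j + d.+1)%N))%:R * t (j + d.+1)%N `^ p)) +
    k1 / 2 ^+ q * (t j `^ p * nn j)) + 2 * m%:R * (4 * t J) `^ p)).
  rewrite lerD//; apply: le_trans (ler_norm_sum _ _ _) _.
  apply: ler_sum => j _; apply: (le_trans (ler_normD _ _)); rewrite lerD//.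
  apply: le_trans (ler_norm_sum _ _ _) _; apply: ler_sum => d _.
  by apply: link_disc => //; rewrite -ltnS.
rewrite big_split /= -mulr_sumr exchange_big /=.
have wt_sum : \sum_(d < q.+1) wt d <= G / (G - 1).
  exact: sum_geometric_top_le.
set B := 12 * U * G ^+ 2 * (G ^+ q) ^+ 2 / eps.
have B0 : 0 <= B.
  by rewrite /B divr_ge0 ?(ltW eps_gt0)// !mulr_ge0 ?exprn_ge0 ?(ltW U_gt0) ?(ltW G0).
have T0 : 0 <= T by apply: pair_sum_ge0 => x; exact: powR_ge0.
have K0 : 0 <= K by have := csum 0%N; rewrite big_ord0.
have inner : \sum_(d < q.+1) \sum_(j < J)
    (4 * eps * k1 ^+ 2 * wt d * (t j `^ p * nn j) +
     B * wt d * ((size (c (j + d.+1)%N))%:R * t (j + d.+1)%N `^ p)) <=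
    (G / (G - 1)) * (8 * eps * k1 ^+ 2 * T + B * K).
  apply: (@le_trans _ _ (\sum_(d < q.+1) wt d * (8 * eps * k1 ^+ 2 * T + B * K))).
    apply: ler_sum => d _; rewrite big_split /= -!mulr_sumr mulrDr lerD//.
      have e0 : 0 <= 4 * eps * k1 ^+ 2 * wt d.
        apply: mulr_ge0 (ltW (wt_gt0 d)).
        by apply: mulr_ge0; [rewrite mulr_ge0// ltW|exact: exprn_ge0].
      apply: (le_trans (ler_wpM2l e0 sum_nn)).
      by rewrite le_eqVlt; apply/orP; left; apply/eqP; ring.
    have e0 : 0 <= B * wt d by rewrite mulr_ge0// ltW.
    apply: (le_trans (ler_wpM2l e0 (csum' d))).
    by rewrite le_eqVlt; apply/orP; left; apply/eqP; ring.
  have e0 : 0 <= 8 * eps * k1 ^+ 2.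
    by apply: mulr_ge0; [rewrite mulr_ge0// ltW|exact: exprn_ge0].
  by rewrite -mulr_suml ler_wpM2r// addr_ge0// mulr_ge0.
have k2 : 0 <= k1 / 2 ^+ q by rewrite divr_ge0// exprn_ge0.
have tail := ler_wpM2l k2 sum_nn.
rewrite /chaining_bound /chaining_slope /chaining_offset -/k1 -/T.
apply: (@le_trans _ _ ((G / (G - 1)) * (8 * eps * k1 ^+ 2 * T + B * K) +
    k1 / 2 ^+ q * (2 * T) + 2 * m%:R * (4 * t J) `^ p)).
  by rewrite lerD2r lerD.
rewrite le_eqVlt; apply/orP; left; apply/eqP; rewrite /B.
by field; rewrite expf_neq0//= (gt_eqF eps_gt0) subr_eq0 (gt_eqF G_gt1).
Qed.

Theorem rademacher_chaining :
  prod_prob fair (fun sg => `[< exists2 r, fam r &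
    chaining_bound r < `|pair_disc sg (fun x => r x `^ p)| >]) <=
  48 * expR (- U).
Proof.
have tauJ : 0 < t (J + q)%N `^ p by rewrite powR_gt0.
(* No code used in a chain is longer: [size (c i) * t i ^ p <= K], and the finest scale that occurs
   is [t (J + q)]. *)
pose S := Num.bound `|K / t (J + q)%N `^ p|.
apply: le_trans (bad_total S).
apply: prod_prob_union => [|sg /asboolP[r fr]]; first exact: fair_ge0.
rewrite ltNge => /negP h; apply: contrapT => hn; apply: h.
apply: (@chaining_det S _ _ fr) => [c cK i iJq|w wl]; last first.
  by apply/negP => wb; apply: hn; apply/hasP; exists w.
have t_anti i' k : t (i' + k)%N <= t i'.
  elim: k => [|k IH]; first by rewrite addn0.
  by rewrite addnS t_half; have := t_gt0 (i' + k)%N; lra.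
have ti : t (J + q)%N `^ p <= t i `^ p.
  rewrite -(subnKC iJq); apply: ler_powR2; rewrite ?(ltW p0) ?(ltW (t_gt0 _))//.
have h1 : (size (c i))%:R * t i `^ p <= K.
  apply: le_trans (cK i.+1); rewrite big_ord_recr /= lerDr.
  by apply: sumr_ge0 => j _; rewrite mulr_ge0 ?powR_ge0.
rewrite -(ler_nat R); apply: ltW.
apply: le_lt_trans (archi_boundP (normr_ge0 _)).
apply: le_trans (ler_norm _); rewrite ler_pdivlMr//.
by apply: le_trans h1; rewrite ler_wpM2l.
Qed.

End rademacher_chaining.

(** * Complex moduli and nets for complex-valued samples *)

Section complex_modulus.
Context {R : realType}.
Implicit Types z w : R[i].

Lemma Re_le_normc z : `|complex.Re z| <= Normc.normc z.
Proof.
case: z => a b /=; rewrite -sqrtr_sqr ler_wsqrtr// lerDl; exact: sqr_ge0.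
Qed.

Lemma Im_le_normc z : `|complex.Im z| <= Normc.normc z.
Proof.
case: z => a b /=; rewrite -sqrtr_sqr ler_wsqrtr// lerDr; exact: sqr_ge0.
Qed.

Lemma normc_le_ReIm z : Normc.normc z <= `|complex.Re z| + `|complex.Im z|.
Proof.
case: z => a b /=.
have ab : 0 <= `|a| * `|b| by exact: mulr_ge0.
have h : a ^+ 2 + b ^+ 2 <= (`|a| + `|b|) ^+ 2.
  by rewrite sqrrD !real_normK ?num_real// -mulr_natl; lra.
by rewrite -[leRHS]ger0_norm ?addr_ge0// -sqrtr_sqr; exact: ler_wsqrtr.
Qed.

Lemma normc_ge0 z : 0 <= Normc.normc z.
Proof. by case: z => a b; exact: sqrtr_ge0. Qed.

Lemma normc_triangle z w : Normc.normc (z + w) <= Normc.normc z + Normc.normc w.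
Proof. exact: le_normcD. Qed.

Lemma normc_opp z : Normc.normc (- z) = Normc.normc z.
Proof. exact: normcN. Qed.

Lemma normc_dist z w : `|Normc.normc z - Normc.normc w| <= Normc.normc (z - w).
Proof.
have h1 := normc_triangle (z - w) w; have h2 := normc_triangle (w - z) z.
rewrite subrK in h1; rewrite subrK -opprB normc_opp in h2.
by rewrite ler_norml; lra.
Qed.

End complex_modulus.

Section sampled_net.
Context {R : realType} {V : Type} {Z : finType}.
Variables (p H : R) (psi : V -> R) (mid : V -> V -> V) (D : V -> V -> R).
Variables (ev : V -> Z -> R[i]) (v0 : V).
Hypotheses (p1 : 1 <= p) (H0 : 0 < H).
Hypothesis psi_ge0 : forall g, 0 <= psi g.
Hypothesis psi_mid : forall g h, psi (mid g h) + D g h <= (psi g + psi h) / 2.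
Hypothesis Re_mid : forall g h x, complex.Re (ev (mid g h) x) =
  (complex.Re (ev g x) + complex.Re (ev h x)) / 2.
Hypothesis Im_mid : forall g h x, complex.Im (ev (mid g h) x) =
  (complex.Im (ev g x) + complex.Im (ev h x)) / 2.
Hypothesis ev_le : forall g h x,
  Normc.normc (ev g x - ev h x) `^ p <= 2 `^ p * H * D g h.

(** Twice the descent scale, as real and imaginary parts are controlled separately; the descent
    starts at [H ^ (1 / p)], the bound for [|f|] when [psi f <= 1]. *)
Definition net_scale i : R := 2 * (H `^ p^-1 / 2 ^+ i).

Definition net_size : R := 2 `^ p * 4 * ((greedy_rate p)^-1 + 1).

(** A point, a sign and a choice of real or imaginary part; with both signs available, the one-sided
    bounds of the descent become two-sided. The outer [option] adds the change of scale. *)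
Definition net_code : finType := option (Z * (bool * bool))%type.

Lemma sampled_net : exists h : seq net_code -> V, forall f, psi f <= 1 ->
  exists c : nat -> seq net_code,
  [/\ forall i x, Normc.normc (ev (h (c i)) x - ev f x) <= net_scale i,
      forall i, (i <= size (c i))%N,
      forall i, (size (c i) <= size (c i.+1))%N &
      forall N, \sum_(i < N) (size (c i))%:R * net_scale i `^ p <= net_size * H].
Proof.
pose part (b : bool) (z : R[i]) := if b then complex.Re z else complex.Im z.
pose L (a : Z * (bool * bool)) g : R := (-1) ^+ a.2.1 * part a.2.2 (ev g a.1).
pose s i : R := H `^ p^-1 / 2 ^+ i.
have p0 : 0 < p by exact: lt_le_trans ltr01 p1.
have s0 i : 0 < s i by rewrite divr_gt0 ?powR_gt0 ?exprn_gt0.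
have sh i : s i.+1 = s i / 2 by rewrite /s exprS invfM mulrA mulrAC.
have Lmid a g h : L a (mid g h) = (L a g + L a h) / 2.
  case: a => x [b1 b2]; rewrite /L /=.
  by case: b2; rewrite /part ?Re_mid ?Im_mid -mulrDr mulrA.
have part_le b z w : `|part b z - part b w| <= Normc.normc (z - w).
  case: b => /=.
    by apply: le_trans (Re_le_normc _); case: z w => ? ? [? ?].
  by apply: le_trans (Im_le_normc _); case: z w => ? ? [? ?].
have Lle a g h : `|L a g - L a h| `^ p <= 2 `^ p * H * D g h.
  apply: le_trans (ev_le g h a.1); apply: ler_powR2; rewrite ?(ltW p0)//.
  by rewrite /L -mulrBr normrM normr_sign mul1r.
exists (greedy_point v0 p1 H0 psi_ge0 psi_mid Lmid Lle s0) => f f1.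
have [c [c1 c2 c3 c4]] :=
  greedy_codes v0 p1 H0 psi_ge0 psi_mid Lmid Lle s0 sh f1.
exists c; split => // [i x|N].
  set h := greedy_point _ _ _ _ _ _ _ _ _.
  have half b : `|part b (ev h x) - part b (ev f x)| <= s i.
    have := c1 i (x, (false, b)); have := c1 i (x, (true, b)).
    rewrite /L /= -/h expr0 expr1 !mul1r !mulN1r.
    by rewrite ler_norml; lra.
  apply: (le_trans (normc_le_ReIm _)); rewrite /net_scale -/(s i).
  have := half true; have := half false; rewrite /part.
  case: (ev h x) (ev f x) => [a1 a2] [b1 b2] /=; lra.
have -> : net_size * H = 2 `^ p * (4 * (H / greedy_rate p + s 0%N `^ p)).
  rewrite /net_size /s expr0 divr1 -powRrM mulVf ?gt_eqF// powRr1 ?(ltW H0)//.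
  by ring.
apply: le_trans (ler_wpM2l (powR_ge0 2 p) (c4 N)).
rewrite mulr_sumr; apply: ler_sum => i _.
by rewrite /net_scale powRM ?(ltW (s0 i))// mulrCA.
Qed.

End sampled_net.

(** * Deviation under random signs *)

Ltac positivity := repeat first [assumption | by rewrite ltr0n | apply: mulr_gt0
  | rewrite invr_gt0 | apply: exprn_gt0 | apply: powR_gt0 | done].

Section random_signs.
Context {R : realType}.

Lemma pow2_unbounded (x : R) : exists q : nat, x <= 2 ^+ q.
Proof.
exists (Num.bound `|x|); apply: le_trans (ler_norm x) _.
apply: le_trans (ltW (archi_boundP (normr_ge0 x))) _.
by rewrite -natrX ler_nat ltnW// ltn_expl.
Qed.

Lemma pow2_bracket (x : R) : 1 <= x -> exists q : nat, x <= 2 ^+ q <= 2 * x.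
Proof.
move=> x1; pose P q := x <= 2 ^+ q.
have exP : exists q, P q by exact: pow2_unbounded.
exists (ex_minn exP); case: ex_minnP => -[|q] Pq qmin; rewrite -/(P _) Pq /=.
  by rewrite expr0; lra.
rewrite exprS ler_pM2l// leNgt; apply/negP => /ltW/qmin.
by rewrite ltnn.
Qed.

(* [ev f x] plays the role of [f(x)], [psi] of the [p]-th power of the norm, and
   [D f g] of [psi] of half the difference, so that [psi_mid] is Clarkson's
   inequality. *)
Record convex_system (V T : Type) (p H : R) (psi : V -> R)
    (mid : V -> V -> V) (D : V -> V -> R) (ev : V -> T -> R[i]) : Prop := {
  psi_ge0 : forall g, 0 <= psi g ;
  psi_mid : forall g h, psi (mid g h) + D g h <= (psi g + psi h) / 2 ;
  Re_mid : forall g h x, complex.Re (ev (mid g h) x) =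
    (complex.Re (ev g x) + complex.Re (ev h x)) / 2 ;
  Im_mid : forall g h x, complex.Im (ev (mid g h) x) =
    (complex.Im (ev g x) + complex.Im (ev h x)) / 2 ;
  ev_dist : forall g h x,
    Normc.normc (ev g x - ev h x) `^ p <= 2 `^ p * H * D g h ;
  ev_bound : forall g x, psi g <= 1 -> Normc.normc (ev g x) `^ p <= H
}.

Definition modpow (V T : Type) (p : R) (ev : V -> T -> R[i]) (f : V) (x : T) : R :=
  Normc.normc (ev f x) `^ p.

Lemma rademacher_sampled (p : R) : 2 < p -> exists2 C : R, 0 < C &
  forall (V T : Type) (m : nat) (H eps U : R) (psi : V -> R)
    (mid : V -> V -> V) (D : V -> V -> R) (ev : V -> T -> R[i]) (v0 : V)
    (x x' : 'I_m -> T),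
  convex_system p H psi mid D ev -> (0 < m)%N -> 0 < H -> 0 < eps <= 1 ->
  0 < U -> (8 * m + 1)%N%:R * expR (- U) <= 1 / 2 ->
  C * U * H / eps `^ p <= m%:R ->
  prod_prob fair (fun sg => `[< exists2 f, psi f <= 1 &
    eps / 16 * (\sum_j (modpow p ev f (x j) + modpow p ev f (x' j)) + m%:R) <
    `|signed_sum (fun j => modpow p ev f (x j) - modpow p ev f (x' j)) sg| >]) <=
  48 * expR (- U).
Proof.
move=> p2; have p0 : 0 < p by lra.
have [n pn] : exists n : nat, p <= n%:R.
  by exists (Num.bound p); rewrite ltW// archi_boundP// ltW.
have n1 : (1 < n)%N by rewrite -(ltr_nat R); lra.
have p1n : 1 <= p <= n%:R by rewrite pn andbT; lra.
(* Solves [4 * G ^+ 2 = 2 ^ p]; it exceeds 1 exactly when [p > 2]. *)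
pose G : R := 2 `^ ((p - 2) / 2).
have G1 : 1 < G.
  rewrite /G /powR pnatr_eq0/= expR_gt1 mulr_gt0 ?ln_gt0 ?ltr1n//.
  by rewrite divr_gt0//; lra.
have G2 : G ^+ 2 = 2 `^ (p - 2).
  by rewrite -powR_mulrn ?powR_ge0// -powRrM; congr (_ `^ _); field.
have GE : 4 * G ^+ 2 = 2 `^ p.
  rewrite G2 (_ : 4 = 2 `^ 2); last by rewrite powR_mulrn// expr2; lra.
  rewrite -powRD; last by rewrite pnatr_eq0 implybT.
  by congr (_ `^ _); ring.
pose k1 := increment_const p n.
have k1_ge1 : 1 <= k1.
  have n2 : 2 <= n%:R :> R by rewrite ler_nat.
  have f1 : 1 <= 4 `^ (p - 1) by rewrite -[leLHS](@powRr0 _ 4); apply: ler_powR; lra.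
  by rewrite /k1 /increment_const; nra.
have k10 : 0 < k1 by lra.
pose Cg := G / (G - 1).
have Cg0 : 0 < Cg by rewrite divr_gt0; lra.
pose k0 : R := net_size p.
have k00 : 0 < k0.
  rewrite /k0 /net_size mulr_gt0// ?mulr_gt0 ?powR_gt0// ltr_wpDl//.
  by rewrite invr_ge0 powR_ge0.
pose C1 := 12 * G ^+ 2 * Cg * k0 * (128 * k1) `^ (p - 2) * (256 * k1 ^+ 2 * Cg).
have G0 : 0 < G by lra.
have C10 : 0 < C1.
  by rewrite /C1; positivity.
exists (32 * C1); first by rewrite mulr_gt0.
move=> V T m H eps U psi mid D ev v0 x x' cs m0 H0 /andP[e0 e1] U0 Um hm.
pose Z : finType := ('I_m * bool)%type.
pose pt (z : Z) := if z.2 then x z.1 else x' z.1.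
pose evZ g (z : Z) := ev g (pt z).
have p1 : 1 <= p by lra.
have [h hnet] := sampled_net v0 p1 H0 (psi_ge0 cs) (psi_mid cs)
  (fun g k (z : Z) => Re_mid cs g k (pt z))
  (fun g k (z : Z) => Im_mid cs g k (pt z))
  (fun g k (z : Z) => ev_dist cs g k (pt z)).
pose t := net_scale p H.
have Hp0 : 0 < H `^ p^-1 by rewrite powR_gt0.
have t0 i : 0 < t i by rewrite /t /net_scale mulr_gt0// divr_gt0// exprn_gt0.
have th i : t i.+1 = t i / 2.
  by rewrite /t /net_scale exprS invfM mulrA; ring.
(* The lower bound on [2 ^+ q] makes the stopping error [2 * k1 / 2 ^+ q] at most [eps / 32]; the
   upper bound keeps [(G ^+ q) ^+ 2], which enters the offset, of order [eps^-(p-2)]. *)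
have [q /andP[q1 q2]] : exists q : nat, 64 * k1 / eps <= 2 ^+ q <= 2 * (64 * k1 / eps).
  apply: pow2_bracket; rewrite ler_pdivlMr//; lra.
(* Makes the values below the last band contribute at most [eps / 32 * m]; [J] may be this large
   because the probability bound does not depend on it. *)
have [J hJ] := pow2_unbounded (64 * (8 * H `^ p^-1) `^ p / eps).
(* Rescaled so that the variance term of the slope equals [eps / 32]. *)
pose e1' := eps / (256 * k1 ^+ 2 * Cg).
have e1'0 : 0 < e1' by rewrite /e1'; positivity.
pose fam : set (Z -> R) :=
  [set r | exists2 f, psi f <= 1 & r = fun z => Normc.normc (evZ f z)].
have U_half : expR (- U) <= 1 / 2.
  apply: le_trans Um; rewrite ler_peMl ?expR_ge0// -[leLHS]/(1%N%:R) ler_nat.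
  by rewrite addn1.
have fam_b r : fam r -> forall z, 0 <= r z <= 4 * t 0%N.
  move=> [f f1 ->] z; rewrite normc_ge0/=.
  have fH : Normc.normc (evZ f z) `^ p <= H by exact: (ev_bound cs).
  have : Normc.normc (evZ f z) <= H `^ p^-1.
    have := @ler_powR2 R p^-1 _ _ _ (powR_ge0 _ _) fH.
    rewrite -powRrM mulfV ?gt_eqF// powRr1 ?normc_ge0//.
    by apply; rewrite invr_ge0 ltW.
  by rewrite /t /net_scale expr0 divr1; lra.
have fam_c r : fam r -> exists c : nat -> seq (@net_code Z),
  [/\ forall i z, `|Normc.normc (evZ (h (c i)) z) - r z| <= t i,
      forall i, (i <= size (c i))%N,
      forall i, (size (c i) <= size (c i.+1))%N &
      forall N, \sum_(i < N) (size (c i))%:R * t i `^ p <= k0 * H].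
  move=> [f f1 ->]; have [c [c1 c2 c3 c4]] := hnet f f1; exists c; split => //.
  by move=> i z; apply: le_trans (normc_dist _ _) (c1 i z).
have UZ : #|@net_code Z|%:R * expR (- U) <= 1 / 2.
  apply: le_trans Um; rewrite ler_wpM2r ?expR_ge0// ler_nat.
  by rewrite card_option !card_prod card_bool card_ord addn1 ltnS -mulnA mulnC.
have main := @rademacher_chaining R (@net_code Z) Z m p n t
  (fun c z => Normc.normc (evZ (h c) z)) (fun j => (j, true)) (fun j => (j, false))
  fam U (k0 * H) G e1' q J p1n n1 t0 th (fun c z => normc_ge0 _) e1'0 U0 UZ U_half
  G1 GE fam_b fam_c.
apply: le_trans main; apply: prod_prob_le => [|sg /asboolP[f f1 hf]].
  exact: fair_ge0.
apply/asboolP; exists (fun z => Normc.normc (evZ f z)); first by exists f.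
apply: le_lt_trans hf.
set TT := \sum_j _; have TT0 : 0 <= TT.
  by apply: sumr_ge0 => j _; rewrite addr_ge0// powR_ge0.
rewrite /chaining_bound -[pair_sum _ _ _]/TT.
have slope : chaining_slope p n G e1' q <= eps / 16.
  rewrite /chaining_slope -/k1 -/Cg.
  have -> : 8 * e1' * k1 ^+ 2 * Cg = eps / 32.
    by rewrite /e1'; field; rewrite !gt_eqF.
  have : k1 / 2 ^+ q <= eps / 64.
    rewrite ler_pdivrMr ?exprn_gt0//.
    by move: q1; rewrite ler_pdivrMr//; lra.
  lra.
have low : 2 * m%:R * (4 * t J) `^ p <= eps / 32 * m%:R.
  have -> : 2 * m%:R * (4 * t J) `^ p = 2 * (4 * t J) `^ p * m%:R by ring.
  rewrite ler_wpM2r//.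
  have -> : 4 * t J = 8 * H `^ p^-1 * (2 ^+ J)^-1 by rewrite /t /net_scale; ring.
  have J0 : 0 < 2 ^+ J :> R by rewrite exprn_gt0.
  have J01 : 0 < (2 ^+ J : R)^-1 <= 1.
    by rewrite invr_gt0 J0 invf_le1// exprn_ege1//; lra.
  rewrite powRM ?invr_ge0 ?(ltW J0)//; last by rewrite mulr_ge0// ltW.
  have := ge1r_powR J01 p1; set w := _^-1 `^ p.
  move: hJ; rewrite ler_pdivrMr//; set a := (8 * _) `^ p => hJ hw.
  have a0 : 0 <= a by exact: powR_ge0.
  have : a * w <= a / 2 ^+ J by rewrite ler_wpM2l.
  have : a / 2 ^+ J <= eps / 64 by rewrite ler_pdivrMr//; lra.
  lra.
have off : chaining_offset U (k0 * H) G e1' q <= eps / 32 * m%:R.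
  have Gq : (G ^+ q) ^+ 2 <= (128 * k1) `^ (p - 2) / eps `^ (p - 2).
    rewrite -exprM mulnC exprM G2 -powR_mulrn ?powR_ge0// -powRrM mulrC powRrM.
    rewrite powR_mulrn// ler_pdivlMr ?powR_gt0// -powRM ?exprn_ge0 ?(ltW e0)//.
    apply: ler_powR2; [lra|by rewrite mulr_ge0 ?exprn_ge0 ?(ltW e0)|].
    apply: (le_trans (ler_wpM2r (ltW e0) q2)).
    by rewrite le_eqVlt; apply/orP; left; apply/eqP; field; rewrite gt_eqF.
  have E : chaining_offset U (k0 * H) G e1' q =
      12 * G ^+ 2 * Cg * k0 * (256 * k1 ^+ 2 * Cg) * U * H / eps * (G ^+ q) ^+ 2.
    rewrite /chaining_offset -/Cg /e1'; field.
    by rewrite !gt_eqF.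
  rewrite E.
  set c := 12 * _ * _ * _ * _.
  have c0 : 0 < c by rewrite /c; positivity.
  apply: (@le_trans _ _ (c * U * H / eps * ((128 * k1) `^ (p - 2) / eps `^ (p - 2)))).
    by rewrite ler_wpM2l//; apply: ltW; positivity.
  apply: (@le_trans _ _ (eps / 32 * (32 * C1 * U * H / eps `^ p))); last first.
    by rewrite ler_wpM2l// divr_ge0// ltW.
  have -> : eps `^ p = eps ^+ 2 * eps `^ (p - 2).
    rewrite -powR_mulrn ?(ltW e0)// -powRD; last by rewrite (gt_eqF e0) implybT.
    by congr (_ `^ _); ring.
  rewrite /C1 /c le_eqVlt; apply/orP; left; apply/eqP; field.
  by rewrite !gt_eqF// powR_gt0.
have : chaining_slope p n G e1' q * TT <= eps / 16 * TT by rewrite ler_wpM2r.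
by rewrite mulrDr; move: off low; lra.
Qed.

End random_signs.

(** * Symmetrization *)

Section symmetrization.
Context {R : realType} {Y : finType} {m : nat}.
Variable q : 'I_m -> Y -> R.
Hypothesis q_ge0 : forall j y, 0 <= q j y.
Hypothesis q_sum1 : forall j, \sum_y q j y = 1.
Implicit Types (k : {ffun 'I_m -> Y}) (sg : {ffun 'I_m -> bool}).

Definition swap sg k k' : {ffun 'I_m -> Y} :=
  [ffun j => if sg j then k' j else k j].

Lemma prod_weight_swap sg k k' :
  prod_weight q (swap sg k k') * prod_weight q (swap sg k' k) =
  prod_weight q k * prod_weight q k'.
Proof.
rewrite /prod_weight -!big_split; apply: eq_bigr => j _ /=; rewrite !ffunE.
by case: (sg j) => //; rewrite mulrC.
Qed.

Lemma sum_pair_swap sg (F : {ffun 'I_m -> Y} -> {ffun 'I_m -> Y} -> R) :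
  \sum_k \sum_k' prod_weight q k * prod_weight q k' * F k k' =
  \sum_k \sum_k' prod_weight q k * prod_weight q k' *
    F (swap sg k k') (swap sg k' k).
Proof.
rewrite !pair_big /=.
pose h (x : {ffun 'I_m -> Y} * {ffun 'I_m -> Y}) :=
  (swap sg x.1 x.2, swap sg x.2 x.1).
have hK : involutive h.
  move=> [k k']; congr pair; apply/ffunP => j; rewrite !ffunE /= ?ffunE;
    by case: (sg j).
rewrite (reindex_inj (inv_inj hK)); apply: eq_bigr => x _ /=.
by rewrite prod_weight_swap.
Qed.

(** Exchanging coordinates preserves the joint weight of the pair, so averaging over signs changes
    nothing; the hypothesis then applies with the pair frozen. *)
Lemma random_swap_bound (B : {ffun 'I_m -> Y} -> {ffun 'I_m -> Y} -> bool)
    (b : R) :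
  (forall k k', prod_prob fair
     (fun sg => B (swap sg k k') (swap sg k' k)) <= b) ->
  \sum_k \sum_k' prod_weight q k * prod_weight q k' * (B k k')%:R <= b.
Proof.
move=> Bb; set W := \sum_k _.
have -> : W = \sum_(sg : {ffun 'I_m -> bool}) prod_weight fair sg * W.
  by rewrite -mulr_suml sum_prod_weight ?mul1r// => j; exact: fair_sum1.
apply: (@le_trans _ _ (\sum_k \sum_k' prod_weight q k * prod_weight q k' * b)).
  rewrite (eq_bigr (fun sg : {ffun 'I_m -> bool} => \sum_k \sum_k'
      prod_weight q k * prod_weight q k' *
      (prod_weight fair sg * (B (swap sg k k') (swap sg k' k))%:R))).
    rewrite exchange_big; apply: ler_sum => k _ /=.
    rewrite exchange_big; apply: ler_sum => k' _ /=.
    rewrite -mulr_sumr ler_wpM2l ?mulr_ge0 ?prod_weight_ge0//.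
    exact: Bb.
  move=> sg _; rewrite /W (sum_pair_swap sg) mulr_sumr; apply: eq_bigr => k _.
  by rewrite mulr_sumr; apply: eq_bigr => k' _; rewrite mulrCA.
under eq_bigr do rewrite -mulr_suml -mulr_sumr sum_prod_weight// mulr1.
by rewrite -mulr_suml sum_prod_weight// mul1r.
Qed.

(** Each bad sample has ghost partners of total weight at least 1/2 that make the pair bad, so
    passing to pairs costs a factor 2. *)
Lemma ghost_sample_bound (E : pred {ffun 'I_m -> Y})
    (B : {ffun 'I_m -> Y} -> {ffun 'I_m -> Y} -> bool) (b : R) :
  (forall k, E k -> 1 / 2 <= prod_prob q (B k)) ->
  (forall k k', prod_prob fair
     (fun sg => B (swap sg k k') (swap sg k' k)) <= b) ->
  prod_prob q E <= 2 * b.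
Proof.
move=> EB /random_swap_bound Wb.
apply: le_trans (ler_wpM2l (ler0n _ 2) Wb); rewrite mulr_sumr.
apply: ler_sum => k _.
under eq_bigr do rewrite -mulrA; rewrite -mulr_sumr mulrCA.
rewrite ler_wpM2l ?prod_weight_ge0//.
have := EB k; rewrite -/(prod_prob q (B k)).
have := @prod_prob_ge0 _ _ _ q (B k) q_ge0.
by case: (E k) => [+ /(_ isT)|+ _] => /=; lra.
Qed.

End symmetrization.

(** With the terms in [z] and [z'] collected on one side, the gap is to first order
    [(1 / 2 - 3 / 16 - 1 / 8) * eps * M], against the required [eps / 16 * M]; the surplus absorbs
    the terms in [eps ^+ 2]. *)
Lemma relative_deviation (R : realFieldType) (eps M z z' : R) :
  0 < eps <= 1 -> 0 < M -> 0 <= z ->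
  `|z' - M| <= eps / 8 * M + eps / 16 * M -> eps / 2 * M < `|z - M| ->
  eps / 16 * (z + z' + M) < `|z - z'|.
Proof.
move=> /andP[e0 e1] M0 z0 h1 h3.
rewrite ltNge; apply/negP => h4.
have em : 0 < eps * M by exact: mulr_gt0.
have eM : eps * eps * M <= eps * M by rewrite -mulrA ler_piMl// ltW.
have eM0 : 0 <= eps * eps * M by rewrite !mulr_ge0// ltW.
have e16 : 0 < 1 - eps / 16 by lra.
have e16' : 0 < 1 + eps / 16 by lra.
move: h1; rewrite ler_norml => /andP[h1 h1'].
move: h4; rewrite ler_norml => /andP[h4 h4'].
move: h3; rewrite ltr_normr => /orP[] h3.
  have {h3} h3 : 0 < z - M - eps / 2 * M by lra.
  have {h1'} h1' : 0 <= eps / 8 * M + eps / 16 * M - (z' - M) by lra.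
  have := mulr_gt0 e16 h3; have := mulr_ge0 (ltW e16') h1'.
  lra.
have {h3} h3 : 0 < M - z - eps / 2 * M by lra.
have {h1} h1 : 0 <= z' - M + (eps / 8 * M + eps / 16 * M) by lra.
have := mulr_gt0 e16' h3; have := mulr_ge0 (ltW e16) h1.
lra.
Qed.

(** The condition on the mean allows an error because quantization later perturbs it: a function of
    norm 1 then has a mean only close to [m]. *)
Lemma finite_discretization (R : realType) (p : R) : 2 < p ->
  exists2 C : R, 0 < C &
  forall (V : Type) (Y : finType) (m : nat) (H eps U : R) (psi : V -> R)
    (mid : V -> V -> V) (D : V -> V -> R) (ev : V -> Y -> R[i]) (v0 : V)
    (q : 'I_m -> Y -> R),
  convex_system p H psi mid D ev -> (0 < m)%N -> 0 < H -> 0 < eps <= 1 ->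
  1 <= U -> (8 * m + 1)%N%:R * expR (- U) <= 1 / 2 ->
  C * U * H / eps `^ p <= m%:R ->
  (forall j y, 0 <= q j y) -> (forall j, \sum_y q j y = 1) ->
  prod_prob q (fun k => `[< exists f, [/\ psi f <= 1,
    `|\sum_j \sum_y q j y * modpow p ev f y - m%:R| <= eps / 16 * m%:R &
    eps / 2 * m%:R < `|\sum_j modpow p ev f (k j) - m%:R| ] >]) <=
  96 * expR (- U).
Proof.
move=> p2; have [C C0 hC] := @rademacher_sampled R p p2.
(* The summand [48 * 64] serves the ghost sample: it makes [m * eps ^+ 2 / H] large enough for a
   Bernstein exponent of at most -3. *)
exists (C + 48 * 64); first by rewrite addr_gt0 ?mulr_gt0.
move=> V Y m H eps U psi mid D ev v0 q cs m0 H0 /andP[e0 e1] U1 Um hm q0 q1.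
have U0 : 0 < U by lra.
have ep0 : 0 < eps `^ p by rewrite powR_gt0.
have mR : 0 < m%:R :> R by rewrite ltr0n.
have hm1 : C * U * H / eps `^ p <= m%:R.
  apply: le_trans hm; rewrite ler_pM2r ?invr_gt0// ler_pM2r// ler_pM2r//; lra.
have hm2 : 48 * 64 * H <= m%:R * eps ^+ 2.
  rewrite -ler_pdivrMr ?exprn_gt0//; apply: le_trans hm.
  apply: (@le_trans _ _ (48 * 64 * H / eps `^ p)).
    rewrite ler_wpM2l ?mulr_ge0 ?(ltW H0)// lef_pV2 ?posrE ?exprn_gt0//.
    rewrite -powR_mulrn ?(ltW e0)//; apply: ger_powR; rewrite ?e0//; exact: ltW.
  rewrite ler_pM2r ?invr_gt0// ler_pM2r//; nra.
pose a f y := modpow p ev f y.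
have a0 f y : 0 <= a f y by exact: powR_ge0.
pose B (k k' : {ffun 'I_m -> Y}) := `[< exists2 f, psi f <= 1 &
    eps / 16 * (\sum_j (a f (k j) + a f (k' j)) + m%:R) <
    `|\sum_j (a f (k j) - a f (k' j))| >].
have -> : 96 * expR (- U) = 2 * (48 * expR (- U)) by ring.
apply: (ghost_sample_bound q0 q1 (B := B)).
- move=> k /asboolP[f [f1 fmean fdev]].
  pose tot := \sum_j \sum_y q j y * a f y.
  have aH y : 0 <= a f y <= H by rewrite a0 (ev_bound cs).
  (* The minimizer of [- g * eps / 8 + 4 * g ^+ 2 * H], which bounds the exponent per sample point
     once [tot <= 2 * m]. *)
  pose g := eps / (64 * H).
  have g0 : 0 < g by rewrite /g; positivity.
  have gH : g * H <= 1 / 2 by rewrite /g invfM mulrA mulfVK ?gt_eqF//; lra.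
  have := bounded_sum_tail q0 q1 aH (eps / 8 * m%:R) g0 gH.
  rewrite -/tot => tail.
  have tot_m : `|tot - m%:R| <= eps / 16 * m%:R by [].
  have em : 0 < eps * m%:R by exact: mulr_gt0.
  have tot2 : tot <= 2 * m%:R.
    have : eps * m%:R <= m%:R by rewrite ler_piMl// ltW.
    by move: tot_m; rewrite ler_norml; lra.
  have expo : - (g * (eps / 8 * m%:R)) + 2 * g ^+ 2 * (H * tot) <= - 3.
    have h1 : 2 * g ^+ 2 * (H * tot) <= 2 * g ^+ 2 * (H * (2 * m%:R)).
      have g20 : 0 <= 2 * g ^+ 2 by rewrite ltW//; positivity.
      by apply: ler_wpM2l => //; apply: ler_wpM2l => //; exact: ltW.
    have h2 : - (g * (eps / 8 * m%:R)) + 2 * g ^+ 2 * (H * (2 * m%:R)) =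
        - (m%:R * eps ^+ 2 / (16 * 64 * H)).
      by rewrite /g; field; rewrite gt_eqF.
    have h3 : 3 <= m%:R * eps ^+ 2 / (16 * 64 * H).
      by rewrite ler_pdivlMr ?mulr_gt0//; lra.
    lra.
  have e3 : 2 * expR (- 3) <= 1 / 2 :> R.
    rewrite expRN.
    have h := expR_ge1Dx (3 : R); have h' : 0 < expR 3 :> R by exact: expR_gt0.
    by rewrite ler_pdivrMr//; lra.
  have tail2 : prod_prob q
      (fun k' => eps / 8 * m%:R < `|\sum_j a f (k' j) - tot|) <= 1 / 2.
    apply: (le_trans tail); apply: le_trans e3; rewrite ler_pM2l//.
    by rewrite ler_expR.
  set E := (fun k' : {ffun 'I_m -> Y} => _) in tail2.
  have : 1 / 2 <= prod_prob q (predC E) by rewrite prod_prob_compl//; lra.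
  move=> /le_trans; apply.
  apply: prod_prob_le => // k' /=; rewrite -leNgt => near.
  apply/asboolP; exists f => //.
  move: fdev; rewrite big_split sumrB /= -/(a f).
  rewrite (eq_bigr (fun j => a f (k j)))//.
  set z := \sum_j a f (k j); set z' := \sum_j a f (k' j).
  apply: relative_deviation => //; first by rewrite e0.
    by apply: sumr_ge0.
  apply: le_trans (lerD near tot_m).
  by have := ler_normD (z' - tot) (tot - m%:R); rewrite addrA subrK.
- move=> k k'.
  apply: le_trans (hC V Y m H eps U psi mid D ev v0 k k' cs m0 H0 _ U0 Um hm1).
    apply: prod_prob_le => [|sg]; first exact: fair_ge0.
    move=> /asboolP[f f1 hf]; apply/asboolP; exists f => //; move: hf.
    have -> : \sum_j (a f (swap sg k k' j) + a f (swap sg k' k j)) =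
        \sum_j (modpow p ev f (k j) + modpow p ev f (k' j)).
      apply: eq_bigr => j _; rewrite !ffunE.
      by case: (sg j) => //; rewrite addrC.
    have -> // : \sum_j (a f (swap sg k k' j) - a f (swap sg k' k j)) =
        signed_sum (fun j => modpow p ev f (k j) - modpow p ev f (k' j)) sg.
    apply: eq_bigr => j _; rewrite !ffunE.
    by case: (sg j); rewrite ?expr1 ?expr0 ?mulN1r ?mul1r ?opprB.
  by rewrite e0 e1.
Qed.

(** * Integrals over the probability space *)

Section power_integral.
Context {R : realType} {d : measure_display} {T : measurableType d}.
Variables (mu : probability T R) (p : R).
Hypothesis p2 : 2 <= p.
Implicit Types (f g : T -> R[i]) (z w : R[i]).

Let p0 : 0 < p.
Proof. by apply: lt_le_trans p2; exact: ltr0n. Qed.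

Definition nice f : Prop := bounded_function f /\ measurable_complex f.

Definition powf f (x : T) : R := Normc.normc (f x) `^ p.

Definition power_int f : R := \int[mu]_x powf f x.

Definition lin (a b : R) f g : T -> R[i] :=
  fun x => real_complex R a * f x + real_complex R b * g x.

Lemma powf_ge0 f x : 0 <= powf f x.
Proof. exact: powR_ge0. Qed.

Lemma normc_powR z (r : R) : 0 < r ->
  Normc.normc z `^ r = (complex.Re z ^+ 2 + complex.Im z ^+ 2) `^ (r / 2).
Proof.
case: z => a b r0 /=; have ab : 0 <= a ^+ 2 + b ^+ 2 by rewrite addr_ge0 ?sqr_ge0.
by rewrite -[Num.sqrt _]powR12_sqrt// -powRrM [2^-1 * _]mulrC.
Qed.

(** By the parallelogram law the two squared moduli add up to the mean of [|z|^2] and [|w|^2];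
    superadditivity and then convexity of the power [p / 2] give the claim. *)
Lemma clarkson z w :
  Normc.normc (real_complex R 2^-1 * z + real_complex R 2^-1 * w) `^ p +
  Normc.normc (real_complex R 2^-1 * z + real_complex R (- 2^-1) * w) `^ p <=
  (Normc.normc z `^ p + Normc.normc w `^ p) / 2.
Proof.
have h1 : 1 <= p / 2 by move: p2; lra.
rewrite !normc_powR//.
have sq (a b : R) : 0 <= a ^+ 2 + b ^+ 2 by rewrite addr_ge0 ?sqr_ge0.
apply: (le_trans (powR_superadd h1 (sq _ _) (sq _ _))).
apply: le_trans (powR_midpoint h1 (sq _ _) (sq _ _)).
rewrite le_eqVlt; apply/orP; left; apply/eqP; congr (_ `^ _).
by case: z w => [a b] [a' b'] /=; field.
Qed.

Lemma measurable_powf f : measurable_complex f -> measurable_fun setT (powf f).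
Proof.
move=> [mRe mIm]; rewrite (_ : powf f = (@powR R ^~ (p / 2)) \o
    ((fun x => complex.Re (f x) ^+ 2) \+ (fun x => complex.Im (f x) ^+ 2))).
  apply: measurableT_comp => //; apply: measurable_funD;
    exact: measurable_funX.
by apply/funext => x /=; rewrite /powf normc_powR.
Qed.

Lemma bounded_normc f : bounded_function f ->
  exists2 M : R, 0 <= M & forall x, Normc.normc (f x) <= M.
Proof.
move=> [M Mub]; exists (Num.max M 0); first by rewrite le_max lexx orbT.
by move=> x; rewrite le_max; apply/orP; left; apply: Mub; exists x.
Qed.

Lemma bounded_integrable (h : T -> R) (M : R) : measurable_fun setT h ->
  (forall x, `|h x| <= M) -> mu.-integrable setT (EFin \o h).
Proof.
move=> mh hM; apply: measurable_bounded_integrable => //.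
  by rewrite (le_lt_trans (probability_le1 mu measurableT))// ltry.
exists M; split; rewrite ?num_real// => N MN x _.
exact: le_trans (hM x) (ltW MN).
Qed.

Lemma Rintegral_const (r : R) : \int[mu]_x r = r.
Proof.
rewrite Rintegral_cst//; transitivity (r * 1); last exact: mulr1.
congr (_ * _); transitivity (fine (1%E : \bar R)) => //; congr fine.
exact: probability_setT.
Qed.

Lemma powf_integrable f : nice f -> mu.-integrable setT (EFin \o powf f).
Proof.
move=> [/bounded_normc[M M0 fM] mf].
apply: (@bounded_integrable _ (M `^ p) (measurable_powf mf)) => x.
rewrite ger0_norm ?powf_ge0//; apply: ler_powR2; rewrite ?(ltW p0)//.
exact: normc_ge0.
Qed.

Lemma power_int_near f g (e : R) : nice f -> nice g ->
  (forall x, `|powf f x - powf g x| <= e) -> `|power_int f - power_int g| <= e.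
Proof.
move=> nf ng fg.
have If := powf_integrable nf; have Ig := powf_integrable ng.
rewrite -RintegralB//; apply: le_trans (le_normr_Rintegral _ _) _ => //.
  by have := integrableB measurableT If Ig.
rewrite -[leRHS]Rintegral_const; apply: le_Rintegral => //.
- by have := integrable_norm (integrableB measurableT If Ig).
- by apply: (@bounded_integrable _ `|e|) => // x; exact: measurable_cst.
Qed.

Lemma power_int_clarkson f g : nice f -> nice g ->
  nice (lin 2^-1 2^-1 f g) -> nice (lin 2^-1 (- 2^-1) f g) ->
  power_int (lin 2^-1 2^-1 f g) + power_int (lin 2^-1 (- 2^-1) f g) <=
  (power_int f + power_int g) / 2.
Proof.
move=> nf ng nm nd.
have If := powf_integrable nf; have Ig := powf_integrable ng.
have Im := powf_integrable nm; have Id := powf_integrable nd.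
have Ifg := integrableD measurableT If Ig.
rewrite -(RintegralD measurableT Im Id) -(RintegralD measurableT If Ig).
rewrite -(RintegralZr 2^-1 measurableT Ifg).
apply: le_Rintegral => //.
- exact: (integrableD measurableT Im Id).
- exact: (integrableZr measurableT 2^-1 (integrableD measurableT If Ig)).
- by move=> x _; exact: clarkson.
Qed.

Lemma power_int_ge0 f : 0 <= power_int f.
Proof. by apply: Rintegral_ge0 => x _; exact: powf_ge0. Qed.

Lemma Lpnorm_powR f : nice f -> Lpnorm mu p f `^ p = power_int f.
Proof.
move=> nf; rewrite /Lpnorm.
have pn0 : p != 0 by rewrite gt_eqF.
have L := powR_Lnorm mu (fun x => (Normc.normc (f x))%:E) pn0.
have E := fine_poweR (Lnorm mu p%:E (fun x => (Normc.normc (f x))%:E)) p.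
rewrite L in E; rewrite -E /power_int /Rintegral; congr fine.
apply: eq_integral => x _ /=.
by rewrite ger0_norm ?normc_ge0// poweR_EFin.
Qed.

End power_integral.

(** * Finite-valued maps and quantization *)

Section finite_valued_maps.
Context {R : realType} {d : measure_display} {W : measurableType d} {Z : finType}.
Variables (P : probability W R) (g : W -> Z).
Hypothesis mg : forall z, measurable (g @^-1` [set z]).

Lemma fiber_split (A : pred Z) :
  measurable [set w | A (g w)] /\
  P [set w | A (g w)] = (\sum_(z | A z) P (g @^-1` [set z]))%E.
Proof.
suff H (s : seq Z) : uniq s -> measurable [set w | g w \in s] /\
    P [set w | g w \in s] = (\sum_(z <- s) P (g @^-1` [set z]))%E.
  have -> : [set w | A (g w)] = [set w | g w \in enum A].
    by apply/seteqP; split => w /=; rewrite mem_enum.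
  by rewrite -big_enum /=; apply: H; exact: enum_uniq.
elim: s => [_|z s IH /= /andP[zs us]].
  have -> : [set w | g w \in [::]] = set0 by apply/seteqP; split.
  by split; [exact: measurable0|rewrite big_nil measure0].
have [ms Ps] := IH us.
have E : [set w | g w \in z :: s] = (g @^-1` [set z]) `|` [set w | g w \in s].
  apply/seteqP; split => w /=; rewrite inE.
    by move=> /orP[/eqP|]; [left|right].
  by move=> [->|->]; rewrite ?eqxx ?orbT.
rewrite E; split; first exact: measurableU.
rewrite measureU//; first by rewrite big_cons; congr (_ + _)%E; exact: Ps.
by apply/seteqP; split => // w /= [->]; exact/negP.
Qed.

Lemma fiber_prob_ge0 z : 0 <= fine (P (g @^-1` [set z])).
Proof. exact: fine_ge0. Qed.

Lemma fiber_probE z :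
  (fine (P (g @^-1` [set z])))%:E = P (g @^-1` [set z]).
Proof. by rewrite fineK// fin_num_measure. Qed.

Lemma fiber_prob_sum1 : \sum_z fine (P (g @^-1` [set z])) = 1.
Proof.
apply: EFin_inj; rewrite -sumEFin -(probability_setT P).
have [_ E] := fiber_split xpredT.
have -> : [set: W] = [set w | xpredT (g w)] by apply/seteqP; split.
by rewrite E; apply: eq_bigr => z _; exact: fiber_probE.
Qed.

Lemma fiber_integral (a : W -> R) (b : Z -> R) (M e : R) :
  measurable_fun setT a -> (forall w, `|a w| <= M) -> (forall z, 0 <= b z) ->
  (forall w, `|a w - b (g w)| <= e) ->
  `|\int[P]_w a w - \sum_z fine (P (g @^-1` [set z])) * b z| <= e.
Proof.
move=> ma aM b0 ab.
pose ind z : W -> R := \1_(g @^-1` [set z]).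
have bE w : b (g w) = \sum_z b z * ind z w.
  rewrite (bigD1 (g w))//= /ind indicE mem_set// mulr1 big1 ?addr0// => z zg.
  by rewrite indicE memNset ?mulr0//= => /eqP; rewrite eq_sym (negbTE zg).
have mind z : measurable_fun setT (ind z) by exact: measurable_indic.
have mb : measurable_fun setT (b \o g).
  rewrite (_ : b \o g = fun w => \sum_z b z * ind z w); last exact/funext.
  apply: measurable_sum => z; apply: measurable_funM => //.
have ib : \int[P]_w b (g w) = \sum_z fine (P (g @^-1` [set z])) * b z.
  apply: EFin_inj; rewrite -sumEFin /Rintegral.
  have E : (\int[P]_w (b (g w))%:E = \sum_z (b z)%:E * P (g @^-1` [set z]))%E.
    transitivity (\int[P]_w (\sum_z (b z)%:E * (ind z w)%:E))%E.
      by apply: eq_integral => w _; rewrite bE -sumEFin.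
    rewrite ge0_integral_sum//; last 2 first.
    - by move=> z; apply/measurable_EFinP; apply: measurable_funM.
    - by move=> z w _; rewrite -EFinM lee_fin mulr_ge0// /ind indicE.
    apply: eq_bigr => z _; rewrite ge0_integralZl_EFin//.
    - by rewrite integral_indic// setIT.
    - by move=> w _; rewrite lee_fin /ind indicE.
    - exact/measurable_EFinP.
  rewrite E fineK; last first.
    by apply/sum_fin_numP => z _ _; rewrite fin_numM// fin_num_measure.
  by apply: eq_bigr => z _; rewrite EFinM fiber_probE muleC.
rewrite -ib.
have Ia := bounded_integrable P ma aM.
have Ib : P.-integrable setT (EFin \o (b \o g)).
  apply: (@bounded_integrable _ _ _ P _ (M + e)) => // w /=.
  rewrite -[b _](subKr (a w)); apply: (le_trans (ler_normB _ _)).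
  by apply: lerD; [exact: aM|exact: ab].
rewrite -RintegralB//; apply: le_trans (le_normr_Rintegral _ _) _ => //.
  by have := integrableB measurableT Ia Ib.
rewrite -[leRHS](Rintegral_const P); apply: le_Rintegral => //.
- by have := integrable_norm (integrableB measurableT Ia Ib).
- by apply: (@bounded_integrable _ _ _ P _ `|e|) => // x; exact: measurable_cst.
Qed.

End finite_valued_maps.

Section quantization.
Context {R : realType} {d : measure_display} {T : measurableType d}.

(* Makes the sample finite-valued, so that probabilities become finite sums. *)
Lemma quantization (n : nat) (a : 'I_n -> T -> R) (H eta : R) :
  0 < eta -> (forall i, measurable_fun setT (a i)) ->
  (forall i x, 0 <= a i x <= H) ->
  exists (Y : finType) (g : T -> Y),
    (forall y, measurable (g @^-1` [set y])) /\
    forall x x', g x = g x' -> forall i, `|a i x - a i x'| <= eta.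
Proof.
move=> eta0 ma aH.
pose N := Num.truncn (H / eta).
pose lev i x := Num.truncn (a i x / eta).
have lev_itv i x : (lev i x)%:R * eta <= a i x < (lev i x).+1%:R * eta.
  have /andP[a0 _] := aH i x.
  rewrite -ler_pdivlMr// -ltr_pdivrMr//; apply: truncn_itv.
  by rewrite divr_ge0// ltW.
have lev_le i x : (lev i x < N.+1)%N.
  rewrite ltnS; apply: le_truncn; rewrite ler_pM2r ?invr_gt0//.
  by have /andP[] := aH i x.
pose g x : {ffun 'I_n -> 'I_N.+1} := [ffun i => inord (lev i x)].
exists {ffun 'I_n -> 'I_N.+1}, g; split => [y|x x' gxx' i].
  have -> : g @^-1` [set y] = \bigcap_(i in [set: 'I_n])
      (a i @^-1` `[(y i)%:R * eta, (y i).+1%:R * eta[%classic).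
    apply/seteqP; split => x /=.
      move=> <- i _ /=; rewrite in_itv/= ffunE inordK//; exact: lev_itv.
    move=> h; apply/ffunP => i; rewrite ffunE; apply/val_inj.
    rewrite /= inordK//; have := h i I; rewrite /= in_itv/= => /andP[h1 h2].
    have /andP[l1 l2] := lev_itv i x.
    apply/eqP; rewrite eqn_leq.
    apply/andP; split; rewrite -ltnS -(ltr_nat R) -(ltr_pM2r eta0).
      exact: le_lt_trans l1 h2.
    exact: le_lt_trans h1 l2.
  apply: fin_bigcap_measurable => // i _.
  by rewrite -[X in measurable X]setTI; apply: ma.
have E : lev i x = lev i x'.
  by have /ffunP/(_ i)/(congr1 val) := gxx'; rewrite !ffunE /= !inordK.
have := lev_itv i x; have := lev_itv i x'; rewrite E -natr1 mulrDl mul1r.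
by rewrite ler_norml; lra.
Qed.

End quantization.

(** * Subspaces of functions as convex systems *)

Section subspaces.
Context {R : realType} {d : measure_display} {T : measurableType d}.
Variables (mu : probability T R) (p H : R) (X : set (T -> R[i])).
Hypothesis p2 : 2 < p.
Hypothesis H0 : 0 < H.
Hypothesis lX : linear_subspace X.
Hypothesis nX : forall f, X f -> nice f.
Hypothesis sX : forall f, X f -> supnorm f <= H `^ p^-1 * Lpnorm mu p f.
Implicit Types f g : T -> R[i].

Let p0 : 0 < p.
Proof. by have := p2; lra. Qed.

Let p2' : 2 <= p.
Proof. exact: ltW. Qed.

Lemma subspace_lin (a b : R) f g : X f -> X g -> X (lin a b f g).
Proof.
move=> Xf Xg; have [X0 XD] := lX; apply: (XD) => //.
have -> : (fun x => real_complex R b * g x) =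
    (fun x => real_complex R b * g x + (fun=> 0) x).
  by apply/funext => x; rewrite addr0.
exact: XD.
Qed.

Lemma normc_le_supnorm f x : bounded_function f -> Normc.normc (f x) <= supnorm f.
Proof. by move=> bf; apply: ub_le_sup => //; exists x. Qed.

Lemma powf_le f x : X f -> powf p f x <= H * power_int mu p f.
Proof.
move=> Xf; have nf := nX Xf.
rewrite -(Lpnorm_powR mu p2' nf).
have L0 : 0 <= Lpnorm mu p f by apply: fine_ge0; exact: Lnorm_ge0.
have -> : H * Lpnorm mu p f `^ p = (H `^ p^-1 * Lpnorm mu p f) `^ p.
  by rewrite powRM ?powR_ge0// -powRrM mulVf ?gt_eqF// powRr1// ltW.
apply: ler_powR2; [exact: ltW|exact: normc_ge0|].
exact: le_trans (normc_le_supnorm x nf.1) (sX Xf).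
Qed.

Lemma subspace_system (Y : Type) (rep : Y -> T) :
  exists (mid : {f | X f} -> {f | X f} -> {f | X f})
         (D : {f | X f} -> {f | X f} -> R),
  convex_system p H (fun u => power_int mu p (sval u)) mid D
    (fun u y => sval u (rep y)).
Proof.
exists (fun u v => exist _ _ (subspace_lin 2^-1 2^-1 (svalP u) (svalP v))).
exists (fun u v => power_int mu p (lin 2^-1 (- 2^-1) (sval u) (sval v))).
split => /=.
- by move=> f; exact: power_int_ge0.
- move=> [f Xf] [g Xg] /=; apply: power_int_clarkson => //; try exact: nX.
    by apply: nX; exact: subspace_lin.
  by apply: nX; exact: subspace_lin.
- move=> [f Xf] [g Xg] y /=; rewrite /lin.
  by case: (f _) (g _) => [a b] [a' b'] /=; field.
- move=> [f Xf] [g Xg] y /=; rewrite /lin.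
  by case: (f _) (g _) => [a b] [a' b'] /=; field.
- move=> [f Xf] [g Xg] y /=.
  have Xh := subspace_lin 2^-1 (- 2^-1) Xf Xg.
  have := powf_le (rep y) Xh; rewrite -(ler_pM2l (powR_gt0 p (ltr0n R 2))) mulrA.
  apply: le_trans; rewrite /powf -powRM ?normc_ge0//.
  rewrite le_eqVlt; apply/orP; left; apply/eqP; congr (_ `^ _).
  rewrite /lin; case: (f _) (g _) => [a b] [a' b'] /=.
  rewrite -[X in _ = X * _](ger0_norm (ler0n R 2)) -sqrtr_sqr -sqrtrM ?sqr_ge0//.
  by congr Num.sqrt; field.
- move=> [f Xf] y /= f1; apply: (le_trans (powf_le _ Xf)).
  by rewrite -[leRHS]mulr1 ler_pM2l.
Qed.

End subspaces.

(** * Discretization for finite families of functions *)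

Section finite_families.
Context {R : realType} {d d' : measure_display}.
Context {T : measurableType d} {W : measurableType d'} {m : nat}.
Variables (P : probability W R) (xi : 'I_m -> {mfun W >-> T}).

Lemma measurable_sample_set (A : set T) j :
  measurable A -> measurable (xi j @^-1` A).
Proof.
by move=> mA; rewrite -[X in measurable X]setTI; apply: (measurable_funP (xi j)).
Qed.

Lemma measurable_sample_sum (a : T -> R) : measurable_fun setT a ->
  measurable_fun setT (fun w => \sum_j a (xi j w)).
Proof.
move=> ma; apply: measurable_sum => j.
by apply: (measurableT_comp ma); exact: measurable_funP.
Qed.

Lemma measurable_deviation_set (a : T -> R) (e : R) : measurable_fun setT a ->
  measurable [set w | `|\sum_j a (xi j w) - m%:R| <= e].
Proof.
move=> ma; rewrite [X in measurable X](_ : _ =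
    (fun w => \sum_j a (xi j w)) @^-1` `[m%:R - e, m%:R + e]%classic).
  rewrite -[X in measurable X]setTI.
  exact: (measurable_sample_sum ma).
by apply/seteqP; split => w /=; rewrite in_itv/= ler_distl.
Qed.

Lemma joint_fiber_probability (Y : finType) (g : T -> Y) (k : {ffun 'I_m -> Y}) :
  independent_points P xi -> (forall y, measurable (g @^-1` [set y])) ->
  let K := fun w => [ffun j => g (xi j w)] in
  measurable (K @^-1` [set k]) /\
  P (K @^-1` [set k]) =
    (prod_weight (fun j y => fine (P ((g \o xi j) @^-1` [set y]))) k)%:E.
Proof.
move=> indep mg K.
have -> : K @^-1` [set k] = \bigcap_(j in [set j | j \in [set: 'I_m]%SET])
    (xi j @^-1` (g @^-1` [set k j])).
  apply/seteqP; split => w /=.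
    by move=> <- j _ /=; rewrite ffunE.
  by move=> h; apply/ffunP => j; rewrite ffunE; apply: h; rewrite /= inE.
split.
  by apply: fin_bigcap_measurable => // j _; exact: measurable_sample_set.
rewrite indep// /prod_weight -prodEFin.
apply: eq_big => [j|j _]; first by rewrite inE.
rewrite fineK// fin_num_measure//.
exact: (measurable_sample_set j (mg (k j))).
Qed.

End finite_families.

(** Only the members of [F] have to be nearly constant on the cells; all other functions enter
    through their values at representatives, where the sup-norm hypothesis still applies. *)
Lemma finite_family_discretization (R : realType) (p : R) : 2 < p ->
  exists2 C : R, 0 < C &
  forall (d d' : measure_display) (T : measurableType d) (mu : probability T R)
    (m : nat) (W : measurableType d') (P : probability W R)
    (xi : 'I_m -> {mfun W >-> T}) (X : set (T -> R[i])) (H eps U : R)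
    (n : nat) (F : 'I_n -> T -> R[i]),
  (0 < m)%N ->
  independent_points P xi ->
  (forall E : set T, measurable E ->
     mu E = ((m%:R^-1)%:E * \sum_(j < m) P (xi j @^-1` E))%E) ->
  linear_subspace X -> (forall f, X f -> nice f) -> 0 < H ->
  (forall f, X f -> supnorm f <= H `^ p^-1 * Lpnorm mu p f) ->
  0 < eps <= 1 -> 1 <= U -> (8 * m + 1)%N%:R * expR (- U) <= 1 / 2 ->
  C * U * H / eps `^ p <= m%:R ->
  (forall i, X (F i)) -> (forall i, power_int mu p (F i) = 1) ->
  ((1 - 96 * expR (- U))%:E <=
    P [set w | forall i,
      (`|\sum_j powf p (F i) (xi j w) - m%:R| <= eps * m%:R)%R])%E.
Proof.
move=> p2; have [C C0 hC] := finite_discretization p2.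
exists C => // d d' T mu m W P xi X H eps U n F m0 indep mean lX nX H0 sX
  /andP[e0 e1] U1 Um hm XF F1.
have p2' : 2 <= p by exact: ltW.
have mR : 0 < m%:R :> R by rewrite ltr0n.
have eta0 : 0 < eps / 16 by rewrite divr_gt0.
have mF i : measurable_fun setT (powf p (F i)).
  by apply: measurable_powf => //; exact: (nX _ (XF i)).2.
have FH i x : 0 <= powf p (F i) x <= H.
  rewrite powf_ge0/=; apply: (le_trans (powf_le p2 H0 nX sX x (XF i))).
  by rewrite F1 mulr1.
have [Y [g [mg gF]]] := quantization eta0 mF FH.
(* A probability space is nonempty; the resulting point of [T] is the default representative of
   cells that contain no point. *)
have [w0 _] : exists w : W, True.
  apply: contrapT => nW; have W0 : [set: W] = set0.
    by apply/seteqP; split => // w _; apply: nW; exists w.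
  have := probability_setT P; rewrite W0 measure0 => /esym/eqP.
  by rewrite onee_eq0.
have [rep repP] : exists rep : Y -> T, forall x, g (rep (g x)) = g x.
  have /choice[rep hrep] : forall y, exists x, (exists x', g x' = y) -> g x = y.
    move=> y; have [[x xy]|nx] := pselect (exists x', g x' = y).
      by exists x.
    by exists (xi (Ordinal m0) w0).
  by exists rep => x; apply: hrep; exists x.
pose q (j : 'I_m) (y : Y) := fine (P ((g \o xi j) @^-1` [set y])).
have mgx j y : measurable ((g \o xi j) @^-1` [set y]).
  exact: (measurable_sample_set xi j (mg y)).
have q0 j y : 0 <= q j y by exact: fiber_prob_ge0.
have q1 j : \sum_y q j y = 1 by exact: fiber_prob_sum1.
have [mid [D cs]] := subspace_system p2 H0 lX nX sX rep.
have [X0 _] := lX.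
have main := hC _ Y m H eps U _ mid D _ (exist X _ X0) q cs m0 H0.
rewrite e0 e1 in main; have {main} main := main isT U1 Um hm q0 q1.
set bad := (fun k : {ffun 'I_m -> Y} => `[< _ >]) in main.
pose K w : {ffun 'I_m -> Y} := [ffun j => g (xi j w)].
have mK k : measurable (K @^-1` [set k]).
  exact: (joint_fiber_probability k indep mg).1.
have [mgood Pgood] := fiber_split P mK (predC bad).
have Pgood' : P [set w | predC bad (K w)] = (prod_prob q (predC bad))%:E.
  rewrite Pgood /prod_prob -sumEFin [RHS](bigID (predC bad))/=.
  rewrite [X in (_ + X)%E]big1 ?adde0; last first.
    by move=> k; rewrite negbK => bk; rewrite bk mulr0.
  apply: eq_bigr => k bk; rewrite bk mulr1.
  exact: (joint_fiber_probability k indep mg).2.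
apply: (@le_trans _ _ (P [set w | predC bad (K w)])).
  by rewrite Pgood' lee_fin prod_prob_compl// lerD2l lerN2.
apply: le_measure; rewrite ?inE//.
  rewrite [X in measurable X](_ : _ = \bigcap_(i in [set: 'I_n])
      [set w | `|\sum_j powf p (F i) (xi j w) - m%:R| <= eps * m%:R]).
    apply: fin_bigcap_measurable => // i _; exact: measurable_deviation_set.
  by apply/seteqP; split => [w h i _|w h i]; [exact: h|exact: (h i I)].
(* Quantization moves the sum by at most [eps / 16 * m], so a deviation above [eps * m] at the true
   sample leaves more than [eps / 2 * m] at the representatives, and [F i] itself witnesses
   [bad]. *)
move=> w /= /asboolPn nbad i; apply: contrapT => /negP; rewrite -ltNge => dev.
apply: nbad; exists (exist X _ (XF i)); split => /=.
- by rewrite F1.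
- have /(_ _)/= := @fiber_integral _ _ _ _ mu g mg (powf p (F i))
    (fun y => powf p (F i) (rep y)) H (eps / 16) (mF i).
  rewrite -/(power_int mu p (F i)) F1 => fi.
  have {}fi : `|1 - \sum_z fine (mu (g @^-1` [set z])) * powf p (F i) (rep z)| <=
      eps / 16.
    apply: fi => [x|y|x]; last by apply: gF; rewrite repP.
      by have /andP[a0 aH] := FH i x; rewrite ger0_norm.
    exact: powf_ge0.
  (* The averaging hypothesis turns the sum of the individual laws into [m] times [mu], cell by
     cell. *)
  have mux z : \sum_j q j z = m%:R * fine (mu (g @^-1` [set z])).
    rewrite (mean _ (mg z)).
    have -> : (\sum_(j < m) P (xi j @^-1` (g @^-1` [set z])))%E = (\sum_j q j z)%:E.
      by rewrite -sumEFin; apply: eq_bigr => j _; rewrite /q fiber_probE.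
    by rewrite /= mulrA mulfV ?gt_eqF// mul1r.
  have -> : \sum_j \sum_y q j y * modpow p (fun f y0 => sval f (rep y0))
      (exist X _ (XF i)) y =
      m%:R * \sum_z fine (mu (g @^-1` [set z])) * powf p (F i) (rep z).
    rewrite exchange_big /= mulr_sumr; apply: eq_bigr => z _.
    by rewrite -mulr_suml mux mulrA.
  rewrite -{2}[m%:R]mulr1 -mulrBr normrM gtr0_norm// mulrC ler_pM2r//.
  by rewrite distrC.
- set s := \sum_j _; pose s' := \sum_j powf p (F i) (xi j w).
  have ss' : `|s' - s| <= eps / 16 * m%:R.
    rewrite /s /s' -sumrB; apply: le_trans (ler_norm_sum _ _ _) _.
    have -> : eps / 16 * m%:R = \sum_(j < m) eps / 16.
      by rewrite sumr_const card_ord mulr_natr.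
    apply: ler_sum => j _; rewrite ffunE /=.
    by apply: gF; rewrite repP.
  have em : 0 < eps * m%:R by exact: mulr_gt0.
  have := ler_normD (s' - s) (s - m%:R).
  rewrite addrA subrK -/s' => tri.
  by move: dev; rewrite -/s'; lra.
Qed.

(** * Reduction to finitely many functions *)

Section separability.
Context {R : realType} {d : measure_display} {T : measurableType d}.
Variables (p : R) (X : set (T -> R[i])).
Hypothesis p1 : 1 <= p.
Hypothesis lX : linear_subspace X.
Hypothesis nX : forall f, X f -> nice f.
Implicit Types f g : T -> R[i].

Lemma subspace_sum N (e : 'I_N -> T -> R[i]) (a : 'I_N -> R[i]) :
  (forall i, X (e i)) -> X (fun x => \sum_(i < N) a i * e i x).
Proof.
move=> Xe; have [X0 XD] := lX.
elim: N e a Xe => [|N IH] e a Xe.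
  rewrite (_ : (fun _ => _) = fun=> 0)//.
  by apply/funext => x; rewrite big_ord0.
rewrite (_ : (fun _ => _) = fun x => a ord0 * e ord0 x +
    \sum_(i < N) a (lift ord0 i) * e (lift ord0 i) x); last first.
  by apply/funext => x; rewrite big_ord_recl.
by apply: XD => //; exact: (IH (fun i => e (lift ord0 i))).
Qed.

Lemma normc_sum N (z : 'I_N -> R[i]) :
  Normc.normc (\sum_(i < N) z i) <= \sum_(i < N) Normc.normc (z i).
Proof.
elim: N z => [|N IH] z; first by rewrite !big_ord0 Normc.normc0.
rewrite !big_ord_recl; apply: (le_trans (normc_triangle _ _)).
by rewrite lerD2l.
Qed.

Lemma rat_complex_near (z : R[i]) (e : R) : 0 < e ->
  exists q : rat * rat, Normc.normc (z - (ratr q.1 +i* ratr q.2)%C) <= e.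
Proof.
move=> e0; case: z => a b.
have near (x : R) : exists q : rat, `|x - ratr q| <= e / 2.
  have : x - e / 2 < x + e / 2 by lra.
  move=> /rat_in_itvoo[q]; rewrite in_itv/= => /andP[q1 q2].
  by exists q; rewrite ler_norml; lra.
have [qa ha] := near a; have [qb hb] := near b.
exists (qa, qb); apply: (le_trans (normc_le_ReIm _)) => /=; lra.
Qed.

Lemma countable_dense : finite_dimensional X -> exists g : nat -> T -> R[i],
  (forall k, X (g k)) /\ forall f (e : R), X f -> 0 < e ->
    exists k, forall x, `|powf p f x - powf p (g k) x| <= e.
Proof.
move=> [N [b [Xb spanb]]]; have [X0 _] := lX.
pose cx (q : rat * rat) : R[i] := (ratr q.1 +i* ratr q.2)%C.
pose G (c : {ffun 'I_N -> rat * rat}) : T -> R[i] :=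
  fun x => \sum_(i < N) cx (c i) * b i x.
exists (fun k => if unpickle k is Some c then G c else fun=> 0); split.
  by move=> k; case: unpickle => [c|] //; exact: subspace_sum.
move=> f e Xf e0.
have [B B0 fB] := bounded_normc (nX Xf).1.
have /choice[M hM] : forall i, exists M : R, 0 <= M /\
    forall x, Normc.normc (b i x) <= M.
  by move=> i; have [M M0 hM] := bounded_normc (nX (Xb i)).1; exists M.
have [n pn] : exists n : nat, p <= n%:R.
  exists (Num.bound p); rewrite ltW// archi_boundP//.
  by apply: le_trans p1.
pose l : R := n%:R * (B + 1) `^ (p - 1) + 1.
have l0 : 0 < l by rewrite /l ltr_wpDl// mulr_ge0// powR_ge0.
pose S := \sum_(i < N) M i.
have S0 : 0 <= S by apply: sumr_ge0 => i _; exact: (hM i).1.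
(* The 1 in the minimum keeps the approximant below [B + 1], the range on which [l] bounds the
   Lipschitz constant; [S + 1] avoids a division by zero. *)
pose dl := Num.min 1 (e / l) / (S + 1).
have m0 : 0 < Num.min 1 (e / l) by rewrite lt_min ltr01 divr_gt0.
have dl0 : 0 < dl by rewrite divr_gt0//; lra.
have [a fE] := spanb f Xf.
have /choice[c hc] := fun i : 'I_N => rat_complex_near (a i) dl0.
exists (pickle [ffun i => c i]) => x; rewrite pickleK.
set g := G _.
have fg : Normc.normc (f x - g x) <= Num.min 1 (e / l).
  rewrite fE /g /G -sumrB; apply: (le_trans (normc_sum _)).
  apply: (@le_trans _ _ (\sum_(i < N) dl * M i)).
    apply: ler_sum => i _; rewrite ffunE -mulrBl Normc.normcM.
    by apply: ler_pM;
      [exact: normc_ge0|exact: normc_ge0|exact: hc|exact: (hM i).2].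
  rewrite -mulr_sumr -/S /dl mulrAC ler_pdivrMr; last by lra.
  by rewrite ler_pM2l//; lra.
have fx := fB x.
have fg1 := le_trans (normc_dist (f x) (g x)) fg.
have gB : Normc.normc (g x) <= B + 1.
  have : `|Normc.normc (f x) - Normc.normc (g x)| <= 1.
    by apply: (le_trans fg1); rewrite ge_min lexx.
  by rewrite ler_norml; lra.
have pn' : 1 <= p <= n%:R by rewrite p1.
have B1 : 0 <= B + 1 by lra.
have := min_powR_lipschitz pn' (normc_ge0 (f x)) (normc_ge0 (g x)) B1.
rewrite !min_l//; last by lra.
move=> /le_trans; apply.
apply: (@le_trans _ _ (l * (e / l))); last by rewrite mulrCA mulfV ?gt_eqF// mulr1.
apply: ler_pM => //; first by rewrite mulr_ge0// powR_ge0.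
  by rewrite /l; lra.
by apply: (le_trans fg1); rewrite ge_min lexx orbT.
Qed.

End separability.

Section events.
Context {R : realType} {d d' : measure_display}.
Context {T : measurableType d} {W : measurableType d'} {m : nat}.
Variables (mu : probability T R) (P : probability W R).
Variables (xi : 'I_m -> {mfun W >-> T}) (X : set (T -> R[i])) (p H eps : R).
Hypothesis p2 : 2 < p.
Hypothesis m0 : (0 < m)%N.
Hypothesis H0 : 0 < H.
Hypothesis eps01 : 0 < eps <= 1.
Hypothesis lX : linear_subspace X.
Hypothesis nX : forall f, X f -> nice f.
Hypothesis fX : finite_dimensional X.
Hypothesis sX : forall f, X f -> supnorm f <= H `^ p^-1 * Lpnorm mu p f.
Implicit Types f g : T -> R[i].

Let p2' : 2 <= p.
Proof. exact: ltW. Qed.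

Let p0 : 0 < p.
Proof. by have := p2; lra. Qed.

Let mR : 0 < m%:R :> R.
Proof. by rewrite ltr0n. Qed.

Let avg f w := m%:R^-1 * \sum_(j < m) powf p f (xi j w).

Definition single_event f : set W :=
  [set w | (1 - eps) * power_int mu p f <= avg f w <= (1 + eps) * power_int mu p f].

Lemma measurable_single_event f : X f -> measurable (single_event f).
Proof.
move=> Xf; have mf := measurable_powf p2' (nX Xf).2.
rewrite [X in measurable X](_ : _ = avg f @^-1`
    `[(1 - eps) * power_int mu p f, (1 + eps) * power_int mu p f]%classic).
  rewrite -[X in measurable X]setTI.
  have ma : measurable_fun setT (avg f).
    by apply: measurable_funM => //; exact: measurable_sample_sum.
  exact: ma.
by apply/seteqP; split => w /=; rewrite in_itv.
Qed.

Lemma event_bigcap (g : nat -> T -> R[i]) : (forall k, X (g k)) ->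
  (forall f (e : R), X f -> 0 < e ->
    exists k, forall x, `|powf p f x - powf p (g k) x| <= e) ->
  discretization_event mu xi X p eps = \bigcap_k single_event (g k).
Proof.
move=> Xg dense; apply/seteqP; split => w /=.
  move=> h k _; have := h _ (Xg k).
  by rewrite (Lpnorm_powR mu p2' (nX (Xg k))).
move=> h f Xf; rewrite (Lpnorm_powR mu p2' (nX Xf)) -/(powf p f _).
rewrite -[X in _ <= X <= _]/(avg f w).
have /andP[e0 e1] := eps01.
have key (e : R) : 0 < e -> exists2 k, `|power_int mu p f - power_int mu p (g k)| <= e &
    `|avg f w - avg (g k) w| <= e.
  move=> e_gt0; have [k hk] := dense f e Xf e_gt0; exists k.
    exact: (power_int_near mu p2' (nX Xf) (nX (Xg k)) hk).
  rewrite /avg -mulrBr -sumrB normrM gtr0_norm ?invr_gt0// mulrC.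
  rewrite ler_pdivrMr//; apply: le_trans (ler_norm_sum _ _ _) _.
  by rewrite mulr_natr -[X in _ *+ X]card_ord -sumr_const ler_sum.
apply/andP; split; apply/ler_addgt0Pr => e e_gt0.
  have [k h1 h2] := key (e / 3) ltac:(lra).
  have /andP[h3 _] := h k I.
  have : (1 - eps) * (power_int mu p f - power_int mu p (g k)) <= 1 * (e / 3).
    apply: (@le_trans _ _ ((1 - eps) * (e / 3))).
      by apply: ler_wpM2l; [lra|exact: le_trans (ler_norm _) h1].
    by rewrite ler_pM2r; lra.
  by move: h2; rewrite ler_norml; lra.
have [k h1 h2] := key (e / 3) ltac:(lra).
have /andP[_ h3] := h k I.
have : (1 + eps) * (power_int mu p (g k) - power_int mu p f) <= 2 * (e / 3).
  apply: (@le_trans _ _ ((1 + eps) * (e / 3))).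
    apply: ler_wpM2l; first by lra.
    by apply: le_trans h1; rewrite distrC ler_norm.
  by rewrite ler_pM2r; lra.
by move: h2; rewrite ler_norml; lra.
Qed.

(** All terms of the event are homogeneous of degree [p] in [f], so a rescaling by a positive real
    suffices. *)
Lemma normalize f : X f -> power_int mu p f != 0 -> exists h,
  [/\ X h, power_int mu p h = 1 &
      forall w, `|\sum_(j < m) powf p h (xi j w) - m%:R| <= eps * m%:R ->
        single_event f w].
Proof.
move=> Xf f0.
have fgt0 : 0 < power_int mu p f by rewrite lt_neqAle eq_sym f0 power_int_ge0.
pose c := (power_int mu p f)^-1 `^ p^-1.
pose h := lin c 0 f f.
have hE x : powf p h x = (power_int mu p f)^-1 * powf p f x.
  rewrite /powf /h /lin [X in _ + X](_ : _ = 0); last first.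
    by case: (f x) => a b; apply/eqP; rewrite eq_complex /= !mul0r subrr addr0 eqxx.
  rewrite addr0 Normc.normcM powRM ?normc_ge0//; congr (_ * _).
  have -> : Normc.normc (real_complex R c) = c.
    by rewrite /= expr0n /= addr0 sqrtr_sqr ger0_norm// powR_ge0.
  by rewrite /c -powRrM mulVf ?gt_eqF// powRr1// invr_ge0 ltW.
have hI : power_int mu p h = 1.
  transitivity (\int[mu]_x ((power_int mu p f)^-1 * powf p f x)).
    by apply: eq_Rintegral => x _; exact: hE.
  by rewrite RintegralZl// ?mulVf//; exact: (powf_integrable mu p2' (nX Xf)).
exists h; split => //; first exact: subspace_lin.
move=> w; under eq_bigr do rewrite hE.
rewrite -mulr_sumr => dev.
have E : \sum_(j < m) powf p f (xi j w) = m%:R * avg f w.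
  by rewrite /avg mulrA mulfV ?gt_eqF// mul1r.
move: dev; rewrite E mulrCA -{2}[m%:R]mulr1 -mulrBr normrM gtr0_norm// [leRHS]mulrC.
rewrite ler_pM2l// /single_event /= ler_distl mulrC.
by rewrite ler_pdivlMr// ler_pdivrMr.
Qed.

(** The sup-norm hypothesis forces such an [f] to vanish at every point, not merely almost
    everywhere, so every sample evaluates it to zero. *)
Lemma null_single_event f w : X f -> power_int mu p f = 0 -> single_event f w.
Proof.
move=> Xf f0.
have z x : powf p f x = 0.
  apply/eqP; rewrite eq_le powf_ge0 andbT.
  by apply: (le_trans (powf_le p2 H0 nX sX x Xf)); rewrite f0 mulr0.
by rewrite /single_event /= /avg f0 big1 ?mulr0 ?lexx.
Qed.

(** The bound for finite families does not depend on their size, so it survives the decreasing limit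
    to a countable intersection. *)
Lemma event_probability (b : R) : b <= 1 ->
  (forall (n : nat) (F : 'I_n -> T -> R[i]), (forall i, X (F i)) ->
    (forall i, power_int mu p (F i) = 1) ->
    (b%:E <= P [set w | forall i,
      (`|\sum_j powf p (F i) (xi j w) - m%:R| <= eps * m%:R)%R])%E) ->
  measurable (discretization_event mu xi X p eps) /\
  (b%:E <= P (discretization_event mu xi X p eps))%E.
Proof.
move=> b1 hF; have [g [Xg dense]] := countable_dense (le_trans (ler1n _ 2) p2') lX nX fX.
have -> := event_bigcap Xg dense.
have mE k : measurable (single_event (g k)) by exact: measurable_single_event.
have mI : measurable (\bigcap_k single_event (g k)).
  by apply: bigcap_measurableType => k _.
split => //.
have [allnull|/existsNP[f0 /not_implyP[Xf0 /eqP f0n]]] :=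
    pselect (forall f, X f -> power_int mu p f = 0).
  rewrite (_ : \bigcap_k _ = setT); last first.
    by apply/seteqP; split => // w _ k _; apply: null_single_event => //; exact: allnull.
  by rewrite probability_setT lee_fin.
(* A normalized stand-in for those [g k] whose norm vanishes and which impose no condition. *)
have [h0 [Xh0 h01 _]] := normalize Xf0 f0n.
have /choice[h hP] : forall k, exists h, [/\ X h, power_int mu p h = 1 &
    forall w, `|\sum_(j < m) powf p h (xi j w) - m%:R| <= eps * m%:R ->
      single_event (g k) w].
  move=> k; have [gk0|gk0] := eqVneq (power_int mu p (g k)) 0.
    by exists h0; split => // w _; exact: null_single_event.
  exact: normalize.
pose E n := \bigcap_(k in [set k | (k < n)%N]) single_event (g k).
have mEn n : measurable (E n).
  by apply: bigcap_measurableType => k _.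
have bE n : (b%:E <= P (E n))%E.
  have Xh (i : 'I_n) : X (h i) by have [] := hP i.
  have h1 (i : 'I_n) : power_int mu p (h i) = 1 by have [] := hP i.
  apply: (le_trans (hF n (fun i => h i) Xh h1)); apply: le_measure; rewrite ?inE//.
    rewrite [X in measurable X](_ : _ = \bigcap_(i in [set: 'I_n])
        [set w | `|\sum_j powf p (h i) (xi j w) - m%:R| <= eps * m%:R]).
      apply: fin_bigcap_measurable => // i _; apply: measurable_deviation_set.
      exact: (measurable_powf p2' (nX (Xh i)).2).
    by apply/seteqP; split => [w hh i _|w hh i]; [exact: hh|exact: (hh i I)].
  move=> w /= hw k kn; have [_ _] := hP k; apply.
  exact: (hw (Ordinal kn)).
have EI : \bigcap_k single_event (g k) = \bigcap_n E n.
  apply/seteqP; split => w hw; first by move=> n _ k _; exact: hw.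
  by move=> k _; apply: (hw k.+1 I) => /=.
rewrite EI; have cv : (P \o E) n @[n --> \oo] --> P (\bigcap_n E n).
  apply: nonincreasing_cvg_mu => //.
  - by rewrite (le_lt_trans (probability_le1 P (mEn 0%N)))// ltry.
  - by rewrite -EI.
  - move=> i j ij; apply/subsetPset => w hw k /= ki; apply: hw.
    exact: leq_trans ki ij.
by apply: cvge_ge cv; apply: nearW => n; exact: bE.
Qed.

End events.

(** * Numerical constants and the final assembly *)

Section constants.
Context {R : realType}.

Lemma expR1_le4 : expR 1 <= 4 :> R.
Proof.
have h : expR (2^-1) <= 2 :> R.
  have := expR_ge1Dx (- 2^-1 : R); rewrite expRN => h.
  have e0 : 0 < expR (2^-1) :> R by exact: expR_gt0.
  rewrite -[leRHS]invrK -[leLHS]invrK lef_pV2 ?posrE ?invr_gt0//; lra.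
have -> : 1 = 2^-1 + 2^-1 :> R by lra.
rewrite expRD; have := expR_ge0 (2^-1 : R); nra.
Qed.

Lemma ln16_gt1 : 1 < ln 16 :> R.
Proof.
rewrite -[ltLHS]expRK ltr_ln ?posrE ?expR_gt0//.
by apply: (le_lt_trans expR1_le4); rewrite ltr_nat.
Qed.

Lemma ln_le_add_ratio (x y : R) : 0 < x -> 0 < y -> ln x <= ln y + x / y.
Proof.
move=> x0 y0; have r0 : 0 < x / y by rewrite divr_gt0.
have -> : ln x = ln y + ln (x / y).
  by rewrite -lnM ?posrE// mulrCA mulfV ?gt_eqF// mulr1.
by rewrite lerD2l ltW// ln_sublinear.
Qed.

(* The logarithm of [m] on the left is absorbed through
   [ln (18 * m) <= ln (18 * y) + m / y] with [y = 2 * C * lam * H / eps `^ p]. *)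
Lemma sample_size_bound (p C : R) : 2 < p -> 0 < C -> exists2 l0 : R, 100 <= l0 &
  forall (m H lam eps : R), 1 <= m -> 16 <= H -> l0 <= lam ->
    0 < eps -> eps <= 1 / 2 ->
    (lam * eps^-1 * ln (eps^-1)) `^ p * H * ln H * ln (ln H) `^ (p - 1) <= m ->
    C * (lam * ln (18 * m)) * H / eps `^ p <= m.
Proof.
move=> p2 C0.
have l16 := ln16_gt1.
pose k0 : R := ln (ln 16) `^ (p - 1).
have k00 : 0 < k0 by rewrite powR_gt0// ln_gt0.
pose l2 : R := ln 2.
have l20 : 0 < l2 by rewrite ln_gt0// ltr1n.
(* Chosen so that [b * (1 + L) <= L ^ p] whenever [L >= ln 2], which [eps <= 1 / 2] ensures for
   [L = ln eps^-1]. *)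
pose b := Num.min (l2 `^ p) (l2 `^ (p - 1)) / 2.
have mb : 0 < Num.min (l2 `^ p) (l2 `^ (p - 1)) by rewrite lt_min !powR_gt0.
have b0 : 0 < b by rewrite divr_gt0.
pose A := Num.max (ln (36 * C)) 0.
have A0 : 0 <= A by rewrite le_max lexx orbT.
(* Two powers of [lam] are spent, one in [y] and one on the sum of logarithms; the surplus
   [lam ^ (p - 2)] exceeds [Q] once [lam >= l0] and absorbs all constants. *)
pose Q := 2 * C * (A + 2 + p) / (b * k0).
have Q0 : 0 < Q by rewrite !(divr_gt0, mulr_gt0)//; lra.
have p20 : 0 < p - 2 by lra.
exists (Num.max 100 (Q `^ (p - 2)^-1)); first by rewrite le_max lexx.
move=> m H lam eps m1 H16 hlam e0 e1 hm.
have m0 : 0 < m by lra.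
have H0 : 0 < H by lra.
have lam100 : 100 <= lam by apply: le_trans hlam; rewrite le_max lexx.
have lam0 : 0 < lam by lra.
have lamQ : Q <= lam `^ (p - 2).
  have -> : Q = (Q `^ (p - 2)^-1) `^ (p - 2).
    by rewrite -powRrM mulVf ?gt_eqF// powRr1// ltW.
  apply: ler_powR2; [exact: ltW|exact: powR_ge0|].
  by apply: le_trans hlam; rewrite le_max lexx orbT.
pose L := ln eps^-1.
have Ll2 : l2 <= L.
  rewrite ler_ln ?posrE ?invr_gt0//.
  by rewrite -[leLHS]invrK lef_pV2 ?posrE ?invr_gt0//; lra.
have L0 : 0 < L by exact: lt_le_trans Ll2.
have lnH : 1 <= ln H.
  by apply: le_trans (ltW l16) _; rewrite ler_ln ?posrE//; lra.
have lnH0 : 0 < ln H by lra.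
have k0le : k0 <= ln (ln H) `^ (p - 1).
  apply: ler_powR2; [lra|by rewrite ltW// ln_gt0|].
  rewrite ler_ln ?posrE//; last by lra.
  by rewrite ler_ln ?posrE//; lra.
have ep0 : 0 < eps `^ p by rewrite powR_gt0.
have Lp : b * (1 + L) <= L `^ p.
  have h1 : b <= L `^ p / 2.
    rewrite ler_pM2r// (@le_trans _ _ (l2 `^ p)) ?ge_min ?lexx//.
    by apply: ler_powR2; rewrite ?(ltW l20)//; lra.
  have h2 : b * L <= L `^ p / 2.
    have -> : L `^ p / 2 = L `^ (p - 1) / 2 * L.
      by rewrite -(mulr_powRB1 (ltW L0) (lt_trans (ltr0n R 2) p2)); ring.
    rewrite ler_pM2r// ler_pM2r// (@le_trans _ _ (l2 `^ (p - 1))) ?ge_min ?lexx ?orbT//.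
    by apply: ler_powR2; rewrite ?(ltW l20)//; lra.
  lra.
pose y := 2 * C * lam * H / eps `^ p.
have y0 : 0 < y by rewrite /y !(divr_gt0, mulr_gt0).
have big : y * (A + lam + ln H + p * L) <= m.
  apply: le_trans hm.
  have -> : (lam * eps^-1 * ln eps^-1) `^ p = lam `^ p * L `^ p / eps `^ p.
    rewrite -/L powRM ?(ltW L0) ?mulr_ge0 ?invr_ge0 ?(ltW lam0) ?(ltW e0)//.
    rewrite powRM ?invr_ge0 ?(ltW lam0) ?(ltW e0)//.
    rewrite -[eps^-1]powR_inv1 ?(ltW e0)// -powRrM mulN1r powRN.
    by ring.
  have lamE : lam `^ p = lam * lam * lam `^ (p - 2).
    rewrite -expr2 -powR_mulrn ?(ltW lam0)// -powRD.
      by congr (_ `^ _); ring.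
    by rewrite (gt_eqF lam0) implybT.
  apply: (@le_trans _ _ (H / eps `^ p * (lam * lam * Q) * (b * (1 + L)) * ln H * k0)).
    have -> : y * (A + lam + ln H + p * L) =
        H / eps `^ p * lam * (2 * C) * (A + lam + ln H + p * L).
      by rewrite /y; ring.
    have -> : H / eps `^ p * (lam * lam * Q) * (b * (1 + L)) * ln H * k0 =
        H / eps `^ p * lam * (2 * C) * ((A + 2 + p) * (lam * (1 + L) * ln H)).
      by rewrite /Q; field; rewrite !gt_eqF.
    rewrite ler_pM2l; last by rewrite !(divr_gt0, mulr_gt0).
    pose z := lam * (1 + L) * ln H.
    have l1L : 1 <= lam * (1 + L) by nra.
    have z1 : 1 <= z by rewrite /z; nra.
    have zlam : lam <= z.
      rewrite /z -mulrA -{1}[lam]mulr1 ler_pM2l//; nra.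
    have zH : ln H <= z.
      by rewrite /z -{1}[ln H]mul1r ler_pM2r.
    have zL : L <= z.
      have : L <= lam * L * ln H.
        by rewrite mulrC mulrA -{1}[L]mul1r ler_pM2r//; nra.
      have : 0 <= lam * ln H by rewrite mulr_ge0 ?ltW.
      by rewrite /z; nra.
    rewrite -/z !mulrDl.
    have : A <= A * z by rewrite -{1}[A]mulr1 ler_wpM2l.
    have : p * L <= p * z by rewrite ler_wpM2l//; lra.
    lra.
  rewrite lamE.
  have -> : lam * lam * lam `^ (p - 2) * L `^ p / eps `^ p * H * ln H *
      ln (ln H) `^ (p - 1) =
      H / eps `^ p * (lam * lam * lam `^ (p - 2)) * L `^ p * ln H *
      ln (ln H) `^ (p - 1) by ring.
  have He : 0 < H / eps `^ p by rewrite divr_gt0.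
  have L1 : 0 < 1 + L by lra.
  have bL : 0 <= b * (1 + L) by apply: ltW; positivity.
  have ll : 0 <= lam * lam by rewrite mulr_ge0 ?ltW.
  apply: ler_pM => //; [|exact: ltW|].
    by apply: ltW; positivity.
  rewrite ler_pM2r//; apply: ler_pM => //.
    by apply: ltW; positivity.
  by rewrite ler_pM2l// ler_wpM2l.
have ln18 : ln (18 * m) <= A + lam + ln H + p * L + m / y.
  have h18 := @ln_le_add_ratio (18 * m) (18 * y) ltac:(lra) ltac:(lra).
  have E : ln (18 * y) = ln (36 * C) + ln lam + ln H + p * L.
    have -> : 18 * y = 36 * C * lam * H * eps^-1 `^ p.
      rewrite /y -[eps^-1]powR_inv1 ?(ltW e0)// -powRrM mulN1r powRN; ring.
    rewrite !lnM ?posrE ?powR_gt0 ?invr_gt0//; try by positivity.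
    by rewrite ln_powR.
  have r : 18 * m / (18 * y) = m / y by field; rewrite gt_eqF.
  have lnA : ln (36 * C) <= A by rewrite le_max lexx.
  have lnlam : ln lam <= lam by rewrite ltW// ln_sublinear.
  by move: h18; rewrite E r; lra.
have -> : C * (lam * ln (18 * m)) * H / eps `^ p = y / 2 * ln (18 * m).
  by rewrite /y; field; rewrite gt_eqF.
apply: (@le_trans _ _ (y / 2 * (A + lam + ln H + p * L + m / y))).
  by rewrite ler_wpM2l// divr_ge0// ltW.
have -> : y / 2 * (A + lam + ln H + p * L + m / y) =
    (y * (A + lam + ln H + p * L) + m) / 2 by field; rewrite gt_eqF.
lra.
Qed.

End constants.

Theorem theorem1p1 (R : realType) (p : R) (hp : 2 < p) :
  exists2 c : R, 0 < c &
  forall (d : measure_display) (T : measurableType d) (mu : probability T R)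
    (m : nat) (d' : measure_display) (W : measurableType d')
    (P : probability W R) (xi : 'I_m -> {mfun W >-> T})
    (X : set (T -> R[i])) (H lambda eps : R),
  (0 < m)%N ->
  independent_points P xi ->
  (forall E : set T, measurable E ->
     mu E = ((m%:R^-1)%:E * \sum_(j < m) P (xi j @^-1` E))%E) ->
  linear_subspace X ->
  finite_dimensional X ->
  (forall f, X f -> bounded_function f /\ measurable_complex f) ->
  16 <= H ->
  (forall f, X f -> supnorm f <= H `^ p^-1 * Lpnorm mu p f) ->
  expR 1 <= lambda ->
  0 < eps -> eps <= 1 / 2 ->
  (lambda * eps^-1 * ln (eps^-1)) `^ p * H * ln H * (ln (ln H)) `^ (p - 1)
    <= m%:R ->
  measurable (discretization_event mu xi X p eps) /\
  ((1 - 2 * expR (- (c * lambda)))%:E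
     <= P (discretization_event mu xi X p eps))%E.
Proof.
have [C C0 hC] := finite_family_discretization hp.
have [l0 l0_100 hl0] := sample_size_bound hp C0.
have l00 : 0 < l0 by lra.
have ln2_gt0 : 0 < ln 2 :> R by rewrite ln_gt0// ltr1n.
have ln2_lt2 : ln 2 < 2 :> R by exact: ln_sublinear.
(* For [lam < l0] this makes [1 - 2 * exp (- c lam)] nonpositive, so that the probability bound is
   trivial there. *)
exists (ln 2 / l0); first by rewrite divr_gt0.
move=> d T mu m d' W P xi X H lam eps m0 indep mean lX fX nX H16 sX lame e0 e12 hm.
have H0 : 0 < H by lra.
have e01 : 0 < eps <= 1 by rewrite e0; lra.
have exp0 (x : R) : 0 < expR x by exact: expR_gt0.
have b1 : 1 - 2 * expR (- (ln 2 / l0 * lam)) <= 1.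
  by have := exp0 (- (ln 2 / l0 * lam)); lra.
apply: (event_probability hp m0 H0 e01 lX nX fX sX b1) => n F XF F1.
have lam1 : 1 <= lam by apply: le_trans lame; have := expR_ge1Dx (1 : R); lra.
have [small|large] := ltP lam l0.
  apply: (@le_trans _ _ 0%E); last exact: measure_ge0.
  rewrite lee_fin subr_le0.
  have : expR (- ln 2) <= expR (- (ln 2 / l0 * lam)).
    rewrite ler_expR lerN2 mulrAC ler_pdivrMr// ler_pM2l//; exact: ltW.
  by rewrite expRN lnK ?posrE//; lra.
have mR : 1 <= m%:R :> R by rewrite ler1n.
have ln18 : 1 <= ln (18 * m%:R) :> R.
  apply: (le_trans (ltW (@ln16_gt1 R))); rewrite ler_ln ?posrE; lra.
(* The 18 fits the alphabet: [8 * m + 1 <= 9 * m], and [exp (- U) <= 1 / (18 * m)] leaves the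
   required 1/2. *)
pose U := lam * ln (18 * m%:R).
have U1 : 1 <= U by rewrite /U; nra.
have lamU : lam <= U by rewrite /U ler_peMr//; lra.
have Um : (8 * m + 1)%N%:R * expR (- U) <= 1 / 2.
  have h1 : expR (- U) <= (18 * m%:R)^-1.
    rewrite expRN lef_pV2 ?posrE//; last by lra.
    rewrite -[leLHS]lnK ?posrE; last by lra.
    by rewrite ler_expR /U ler_peMl//; lra.
  apply: (le_trans (ler_wpM2l (ler0n _ _) h1)).
  by rewrite ler_pdivrMr ?natrD ?natrM; lra.
have := hC _ _ T mu m W P xi X H eps U n F m0 indep mean lX nX H0 sX e01 U1 Um
  (hl0 m%:R H lam eps mR H16 large e0 e12 hm) XF F1.
apply: le_trans; rewrite lee_fin lerD2l lerN2.
have half : expR (- U) <= expR (- (lam / 2)) * expR (- (lam / 2)).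
  by rewrite -expRD ler_expR; lra.
(* Half of the exponent pays for the factor 48, which is where [l0 >= 100] is used. *)
have small : 48 * expR (- (lam / 2)) <= 1.
  rewrite expRN ler_pdivrMr// mul1r.
  by apply: le_trans (expR_ge1Dx _); lra.
have : expR (- (lam / 2)) <= expR (- (ln 2 / l0 * lam)).
  rewrite ler_expR lerN2 mulrC ler_pM2l; last by lra.
  by rewrite ler_pdivrMr//; lra.
have := exp0 (- (lam / 2)); nra.
Qed.
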